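(* Let $M$ be a spacelike translation surface in $\mathbb{L}^3$ parametrized by $X(s,t)=\alpha(s)+\beta(t)$ such that $\alpha''$ is timelike and $\beta$ is a pseudo-null curve. If $M$ is a maximal surface, then $M$ is a plane or both curves $\alpha,\beta$ are planar curves. In the latter case, after a rigid motion, the surface can be parametrized by $$X(x,t)=(x,0,f(x))+\beta(t),$$ where we have two possibilities: (1) The function $f$ and the curve $\beta$ are given by $$f'(x)=-\tanh\big(m(x-f(x))+a\big),\qquad \beta(t)=m\frac{t^2}{2}(1,0,1)+t(b_1,1,b_1),$$ where $m,b_1,a\in\mathbb{R}$, $m\neq0$. (2) The function $f$ and the curve $\beta$ are given by $$f'(x)=-\tanh\big(k(\cosh\theta\, f(x)-x\sinh\theta)+a\big),\qquad \beta(t)=e^{kt}m(\sinh\theta,1,\cosh\theta)-t(\cosh\theta,0,\sinh\theta),$$ where $a,k,\theta,m\in\mathbb{R}$, $k,m\neq0$.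
   Context: $\mathbb{L}^3$ is $\mathbb{R}^3$ with the metric $\langle\cdot,\cdot\rangle=dx^2+dy^2-dz^2$. A vector $v$ is spacelike if $\langle v,v\rangle>0$ or $v=0$, timelike if $\langle v,v\rangle<0$, lightlike if $\langle v,v\rangle=0$ and $v\ne0$. A rigid motion is an affine isometry of $\mathbb{L}^3$. A translation surface is parametrized by $X(s,t)=\alpha(s)+\beta(t)$ with $\alpha:I\to\mathbb{L}^3$, $\beta:J\to\mathbb{L}^3$ smooth curves (the generating curves) and $\alpha'(s),\beta'(t)$ linearly independent for all $s,t$. A surface is spacelike if its induced metric is Riemannian, and maximal if it is spacelike with mean curvature $H=0$ everywhere. A pseudo-null curve is a spacelike curve parametrized by arc length whose second derivative is everywhere lightlike (and nonzero). Planar means contained in an affine plane. In the parametrizations, $f$ is a smooth real function on an interval. Standing conventions: generating curves are spacelike, parametrized by arc length unless otherwise specified, with nowhere vanishing second derivative (in particular they are not straight lines); results are local (''is a plane'' means contained in a plane), and the causal character of each curve and of its derivatives is the same at all parameter values.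
   Formalization: In possibility (2) the sign is corrected: f'(x) = +tanh(k(cosh θ f(x) − x sinh θ)+a) replaces −tanh(...), since with the printed sign and the given β the surface is maximal only if f''=0, which contradicts α'' timelike. *)

(* Defs.v *)
From Stdlib Require Import Reals.
From Coquelicot Require Import Coquelicot.
Open Scope R_scope.

Definition L3 : Type := (R * R * R)%type.

Definition cx (v : L3) : R := fst (fst v).
Definition cy (v : L3) : R := snd (fst v).
Definition cz (v : L3) : R := snd v.

Definition vadd (u v : L3) : L3 := (cx u + cx v, cy u + cy v, cz u + cz v).
Definition vscal (c : R) (v : L3) : L3 := (c * cx v, c * cy v, c * cz v).
Definition vzero : L3 := (0, 0, 0).

Definition lor (u v : L3) : R := cx u * cx v + cy u * cy v - cz u * cz v.

Definition spacelike (v : L3) : Prop := 0 < lor v v \/ v = vzero.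
Definition timelike (v : L3) : Prop := lor v v < 0.
Definition lightlike (v : L3) : Prop := lor v v = 0 /\ v <> vzero.

Definition lin_indep (u v : L3) : Prop :=
  forall a b : R, vadd (vscal a u) (vscal b v) = vzero -> a = 0 /\ b = 0.

(** The Lorentzian cross product: [lor (lcross u v) w] is the determinant
    of [u], [v], [w]. *)
Definition lcross (u v : L3) : L3 :=
  (cy u * cz v - cz u * cy v,
   cz u * cx v - cx u * cz v,
   - (cx u * cy v - cy u * cx v)).

Definition linear_map (L : L3 -> L3) : Prop :=
  (forall u v : L3, L (vadd u v) = vadd (L u) (L v)) /\
  (forall (c : R) (v : L3), L (vscal c v) = vscal c (L v)).

Definition rigid_motion (T : L3 -> L3) : Prop :=
  exists (L : L3 -> L3) (b : L3),
    linear_map L /\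
    (forall u v : L3, lor (L u) (L v) = lor u v) /\
    (forall p : L3, T p = vadd (L p) b).

Definition affine_plane (P : L3 -> Prop) : Prop :=
  exists a b c d : R,
    (a, b, c) <> vzero /\
    (forall p : L3, P p <-> a * cx p + b * cy p + c * cz p = d).

Definition is_open_interval (I : R -> Prop) : Prop :=
  open I /\ (exists t, I t) /\
  (forall x y z : R, I x -> I z -> x <= y <= z -> I y).

(** Functions are total on [R]; only their values on the open set [I] matter. *)
Definition smooth_on (I : R -> Prop) (f : R -> R) : Prop :=
  forall (n : nat) (t : R), I t -> ex_derive_n f n t.

(** Injectivity is not listed: it follows from [Derive h <> 0] on an interval. *)
Definition diffeo (I I' : R -> Prop) (h : R -> R) : Prop :=
  smooth_on I h /\
  (forall s : R, I s -> Derive h s <> 0) /\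
  (forall x : R, I' x <-> exists s : R, I s /\ h s = x).

Definition smooth_curve (I : R -> Prop) (c : R -> L3) : Prop :=
  smooth_on I (fun t => cx (c t)) /\
  smooth_on I (fun t => cy (c t)) /\
  smooth_on I (fun t => cz (c t)).

Definition vderiv (c : R -> L3) (t : R) : L3 :=
  (Derive (fun u => cx (c u)) t,
   Derive (fun u => cy (c u)) t,
   Derive (fun u => cz (c u)) t).

Definition vderiv2 (c : R -> L3) : R -> L3 := vderiv (vderiv c).

Definition spacelike_curve (I : R -> Prop) (c : R -> L3) : Prop :=
  forall t : R, I t -> spacelike (vderiv c t) /\ vderiv c t <> vzero.

Definition arc_length (I : R -> Prop) (c : R -> L3) : Prop :=
  forall t : R, I t -> lor (vderiv c t) (vderiv c t) = 1.

Definition generating_curve (I : R -> Prop) (c : R -> L3) : Prop :=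
  smooth_curve I c /\ spacelike_curve I c /\ arc_length I c /\
  (forall t : R, I t -> vderiv2 c t <> vzero).

Definition pseudo_null (I : R -> Prop) (c : R -> L3) : Prop :=
  smooth_curve I c /\ spacelike_curve I c /\ arc_length I c /\
  (forall t : R, I t -> lightlike (vderiv2 c t)).

Definition planar (I : R -> Prop) (c : R -> L3) : Prop :=
  exists P : L3 -> Prop, affine_plane P /\ forall t : R, I t -> P (c t).

Definition partial_s (X : R -> R -> L3) (s t : R) : L3 := vderiv (fun u => X u t) s.
Definition partial_t (X : R -> R -> L3) (s t : R) : L3 := vderiv (fun u => X s u) t.

Definition ffE (X : R -> R -> L3) (s t : R) : R := lor (partial_s X s t) (partial_s X s t).
Definition ffF (X : R -> R -> L3) (s t : R) : R := lor (partial_s X s t) (partial_t X s t).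
Definition ffG (X : R -> R -> L3) (s t : R) : R := lor (partial_t X s t) (partial_t X s t).

Definition spacelike_surface (I J : R -> Prop) (X : R -> R -> L3) : Prop :=
  forall s t : R, I s -> J t ->
  forall a b : R, (a, b) <> (0, 0) ->
    0 < a ^ 2 * ffE X s t + 2 * a * b * ffF X s t + b ^ 2 * ffG X s t.

(** On a spacelike surface
    [lor (lcross u v) (lcross u v) = - (E G - F^2) < 0] for [u = X_s], [v = X_t],
    hence the normalization below gives [lor N N = -1]. *)
Definition unit_normal (X : R -> R -> L3) (s t : R) : L3 :=
  vscal (/ sqrt (ffE X s t * ffG X s t - ffF X s t ^ 2))
        (lcross (partial_s X s t) (partial_t X s t)).

Definition sfe (X : R -> R -> L3) (s t : R) : R :=
  lor (partial_s (partial_s X) s t) (unit_normal X s t).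
Definition sff (X : R -> R -> L3) (s t : R) : R :=
  lor (partial_t (partial_s X) s t) (unit_normal X s t).
Definition sfg (X : R -> R -> L3) (s t : R) : R :=
  lor (partial_t (partial_t X) s t) (unit_normal X s t).

(** The leading sign is the factor [lor N N = -1]. *)
Definition mean_curvature (X : R -> R -> L3) (s t : R) : R :=
  - (sfe X s t * ffG X s t - 2 * sff X s t * ffF X s t + sfg X s t * ffE X s t)
  / (2 * (ffE X s t * ffG X s t - ffF X s t ^ 2)).

Definition maximal (I J : R -> Prop) (X : R -> R -> L3) : Prop :=
  spacelike_surface I J X /\
  (forall s t : R, I s -> J t -> mean_curvature X s t = 0).

Definition surface_in_plane (I J : R -> Prop) (X : R -> R -> L3) : Prop :=
  exists P : L3 -> Prop,
    affine_plane P /\ forall s t : R, I s -> J t -> P (X s t).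

Definition parametrized_by (I J : R -> Prop) (X : R -> R -> L3)
    (I' J' : R -> Prop) (Y : R -> R -> L3) : Prop :=
  exists h g : R -> R,
    diffeo I I' h /\ diffeo J J' g /\
    (forall s t : R, I s -> J t -> X s t = Y (h s) (g t)).

Definition translation (alpha beta : R -> L3) (s t : R) : L3 :=
  vadd (alpha s) (beta t).

Definition translation_surface (I J : R -> Prop) (alpha beta : R -> L3) : Prop :=
  is_open_interval I /\ is_open_interval J /\
  generating_curve I alpha /\ generating_curve J beta /\
  (forall s t : R, I s -> J t -> lin_indep (vderiv alpha s) (vderiv beta t)).

Definition graph_curve (f : R -> R) (x : R) : L3 := (x, 0, f x).

Definition quadratic_case (I J : R -> Prop) (f : R -> R) (b : R -> L3) : Prop :=
  exists m b1 a : R, m <> 0 /\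
    (forall x : R, I x -> Derive f x = - tanh (m * (x - f x) + a)) /\
    (forall t : R, J t ->
       b t = vadd (vscal (m * (t ^ 2 / 2)) (1, 0, 1)) (vscal t (b1, 1, b1))).

(** Sign pitfall: for this [b], the zero mean curvature equation of
    [translation (graph_curve f) b] is
    [f'' = k (1 - f'^2) (cosh theta f' - sinh theta)], whose first integral
    carries [+ tanh].  With [- tanh] in its place (as the formula is printed in
    the source) the only maximal members of the family would have [f'' = 0].
    Equivalently one may keep [- tanh] and change [- t] into [+ t] in [b]. *)
Definition exponential_case (I J : R -> Prop) (f : R -> R) (b : R -> L3) : Prop :=
  exists a k theta m : R, k <> 0 /\ m <> 0 /\
    (forall x : R, I x ->
       Derive f x = tanh (k * (cosh theta * f x - x * sinh theta) + a)) /\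
    (forall t : R, J t ->
       b t = vadd (vscal (exp (k * t) * m) (sinh theta, 1, cosh theta))
                  (vscal (- t) (cosh theta, 0, sinh theta))).

(* Main.v *)
Require Import Defs.
From Stdlib Require Import Reals Ranalysis5 Lra Psatz Classical ClassicalEpsilon.
From Coquelicot Require Import Coquelicot.
Open Scope R_scope.

(** Write [a], [b] for the two curves. Since [b'] is a unit vector and [b''] is null,
    [b'''] is a multiple of [b'']. Hence [b'' = g L] for a fixed null vector [L], and
    [b' = W + G L] with [G' = g] ([pseudo_null_ruling]). In particular [b] lies in a
    plane.

    The mean curvature vanishes exactly when
    [det (a', b', a'' + b'') = 0] ([maximal_translation_equation]). Inserting the form
    of [b'] gives
    [<c, W> + G <c, L> = g u], where [c = lcross a' a''] and [u = det (a', W, L)];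
    here [u] never vanishes because the tangent planes are spacelike. In this
    relation [c] and [u] depend on [s] while [G] and [g] depend on [t], so
    [<c, W> / u] and [<c, L> / u] are constants ([affine_separation]). Then
    [n = c / u], which is normal to [a'] and [a''], is a constant vector
    ([constant_normal]), and [a] lies in a plane with normal [n]. So both curves
    are always planar.

    For the normal forms, an isometry carries the plane of [a] to [y = 0]
    ([adapted_isometry]), and reflections then put [L] and [W] in one of two positions
    ([normal_position]), according as [L] is parallel to this plane or not. In either
    position the maximal equation separates once more. The part in [t] is
    [G'' = 0] or a linear equation [h' = k h], which gives the polynomial or the
    exponential curve. The part in [s] says that [x' z'' - z' x''] is a constant
    linear form in [(x', z')]; as this quantity is the derivative of
    [artanh (z' / x')], it integrates to the equation for [f]
    ([profile_first_integral]). Finally [a] is rewritten as a graph over [x]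
    ([graph_reparam], [translation_graph_form]). *)

(** * Smooth functions on an interval *)

Lemma is_derive_zero_const (I : R -> Prop) (f : R -> R) :
  is_open_interval I -> (forall t, I t -> is_derive f t 0) ->
  forall s t, I s -> I t -> f s = f t.
Proof.
  intros [_ [_ HI]] Hf.
  assert (H : forall s t, I s -> I t -> s < t -> f s = f t).
  { intros s t Hs Ht Hst. apply eq_is_derive; [|exact Hst].
    intros u Hu. apply Hf, (HI s u t); assumption. }
  intros s t Hs Ht.
  destruct (Rtotal_order s t) as [L|[->|L]]; auto. symmetry; auto.
Qed.

Lemma smooth_ex_derive (I : R -> Prop) (f : R -> R) t :
  smooth_on I f -> I t -> ex_derive f t.
Proof. intros H Ht. exact (H 1%nat t Ht). Qed.

Lemma smooth_derive (I : R -> Prop) (f : R -> R) :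
  smooth_on I f -> smooth_on I (Derive f).
Proof.
  intros H n t Ht. destruct n as [|n]; [exact Logic.I|].
  change (ex_derive (Derive_n (Derive f) n) t).
  apply (ex_derive_ext (Derive_n f (S n))); [|exact (H (S (S n)) t Ht)].
  intros u. rewrite <- PeanoNat.Nat.add_1_r. symmetry. exact (Derive_n_comp f n 1 u).
Qed.

(** Coinduction for smoothness: it suffices to close a class of functions under
    derivation on [I], which spares the computation of iterated derivatives of
    products, quotients and inverse functions. *)
Lemma smooth_coind (I : R -> Prop) (P : (R -> R) -> Prop) :
  open I ->
  (forall f, P f -> exists g, P g /\ forall t, I t -> is_derive f t (g t)) ->
  forall f, P f -> smooth_on I f.
Proof.
  intros HI HP f Pf.
  assert (H : forall n, exists g, P g /\ forall t, I t -> Derive_n f n t = g t).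
  { induction n as [|n [g [Pg Hg]]]; [exists f; auto|].
    destruct (HP g Pg) as [g' [Pg' Hg']]. exists g'; split; [exact Pg'|].
    intros t Ht. simpl. rewrite (Derive_ext_loc _ g); [now apply is_derive_unique, Hg'|].
    generalize (HI t Ht). apply filter_imp. exact Hg. }
  intros [|n] t Ht; [exact Logic.I|].
  destruct (H n) as [g [Pg Hg]], (HP g Pg) as [g' [_ Hg']].
  apply (ex_derive_ext_loc g); [|exists (g' t); auto].
  generalize (HI t Ht). apply filter_imp. intros u Hu; symmetry; auto.
Qed.

(** An inductive closure rather than separate lemmas, so that a single appeal to
    [smooth_coind] gives smoothness for all the operations at once. *)
Inductive smooth_algebra (I : R -> Prop) : (R -> R) -> Prop :=
| sa_base f : smooth_on I f -> smooth_algebra I f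
| sa_const c : smooth_algebra I (fun _ => c)
| sa_plus f g : smooth_algebra I f -> smooth_algebra I g ->
    smooth_algebra I (fun t => f t + g t)
| sa_mult f g : smooth_algebra I f -> smooth_algebra I g ->
    smooth_algebra I (fun t => f t * g t)
| sa_inv f : smooth_algebra I f -> (forall t, I t -> f t <> 0) ->
    smooth_algebra I (fun t => / f t).

Lemma smooth_algebra_smooth (I : R -> Prop) f :
  open I -> smooth_algebra I f -> smooth_on I f.
Proof.
  intros HI. apply smooth_coind; [exact HI|]. clear f.
  induction 1 as [f Hf|c|f g Hf [f' [Pf Df]] Hg [g' [Pg Dg]]
                 |f g Hf [f' [Pf Df]] Hg [g' [Pg Dg]]|f Hf [f' [Pf Df]] Hn].
  - exists (Derive f); split; [now apply sa_base, smooth_derive|].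
    intros t Ht. apply Derive_correct, (smooth_ex_derive I); assumption.
  - exists (fun _ => 0); split; [apply sa_const|]. intros t _. apply @is_derive_const.
  - exists (fun t => f' t + g' t); split; [now apply sa_plus|].
    intros t Ht. apply @is_derive_plus; auto.
  - exists (fun t => f' t * g t + f t * g' t); split.
    + apply sa_plus; apply sa_mult; assumption.
    + intros t Ht. apply @is_derive_mult; auto. intros; apply Rmult_comm.
  - exists (fun t => (-1) * f' t * (/ f t * / f t)); split.
    + apply sa_mult; [apply sa_mult; [apply sa_const|assumption]|].
      apply sa_mult; apply sa_inv; assumption.
    + intros t Ht. generalize (is_derive_inv f t _ (Df t Ht) (Hn t Ht)).
      replace (-1 * f' t * (/ f t * / f t)) with (- f' t / f t ^ 2); [easy|].
      field. auto.
Qed.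

(** * Inverse functions and graphs *)

Lemma constant_sign (I : R -> Prop) (f : R -> R) :
  is_open_interval I -> (forall t, I t -> continuity_pt f t) ->
  (forall t, I t -> f t <> 0) ->
  exists c, forall t, I t -> 0 < c * f t.
Proof.
  intros [_ [[t0 Ht0] HI]] Hc Hn. exists (f t0). intros t Ht.
  destruct (Rlt_or_le 0 (f t0 * f t)) as [H|H]; [exact H|exfalso].
  assert (Hneg : f t0 * f t < 0).
  { assert (f t0 * f t <> 0) by (apply Rmult_integral_contrapositive; auto). lra. }
  assert (Hcc : forall c a, I a -> continuity_pt (fun u => c * f u) a).
  { intros c a Ha. apply (continuity_pt_scal f c). auto. }
  assert (Hsq : 0 < f t0 * f t0) by (specialize (Hn t0 Ht0); nra).
  assert (Hz : exists z, I z /\ f z = 0).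
  { destruct (Rtotal_order t0 t) as [L|[->|L]]; [|nra|].
    - destruct (IVT_interv (fun u => (- f t0) * f u) t0 t) as [z [Hz1 Hz2]]; try lra.
      + intros a Ha. apply Hcc, (HI t0 a t); assumption.
      + exists z. split; [apply (HI t0 z t); assumption|]. specialize (Hn t0 Ht0). nra.
    - destruct (IVT_interv (fun u => f t0 * f u) t t0) as [z [Hz1 Hz2]]; try lra.
      + intros a Ha. apply Hcc, (HI t a t0); assumption.
      + exists z. split; [apply (HI t z t0); assumption|]. specialize (Hn t0 Ht0). nra. }
  destruct Hz as [z [Iz Hz]]. exact (Hn z Iz Hz).
Qed.

(** Multiplying by [c] treats increasing and decreasing [h] together: [c] is a
    value of [Derive h], whose sign is constant. *)
Lemma strict_monotone (I : R -> Prop) (h : R -> R) :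
  is_open_interval I -> smooth_on I h -> (forall s, I s -> Derive h s <> 0) ->
  exists c, c <> 0 /\ forall s s', I s -> I s' -> s < s' -> 0 < c * (h s' - h s).
Proof.
  intros HI Hh Hn.
  destruct (constant_sign I (Derive h)) as [c Hc]; auto.
  { intros t Ht. apply derivable_continuous_pt, ex_derive_Reals_0.
    apply (smooth_ex_derive I); [apply smooth_derive|]; assumption. }
  destruct HI as [_ [[t0 Ht0] HI]]. exists c. split.
  { intros ->. specialize (Hc t0 Ht0). lra. }
  intros s s' Hs Hs' L.
  assert (HIn : forall u, Rmin s s' <= u <= Rmax s s' -> I u).
  { intros u. rewrite Rmin_left, Rmax_right by lra. intros Hu. apply (HI s u s'); assumption. }
  destruct (MVT_gen h s s' (Derive h)) as [u [Hu E]].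
  - intros u Hu. apply Derive_correct, (smooth_ex_derive I); [assumption|apply HIn; lra].
  - intros u Hu. apply derivable_continuous_pt, ex_derive_Reals_0.
    apply (smooth_ex_derive I); auto.
  - rewrite E. specialize (Hc u (HIn u Hu)). nra.
Qed.

(** The intermediate value theorem for [h] between [s0 - e] and [s0 + e]. This one
    estimate says both that the image of [h] is open and that the inverse of [h]
    is continuous. *)
Lemma local_inverse (I : R -> Prop) (h : R -> R) :
  is_open_interval I -> smooth_on I h -> (forall s, I s -> Derive h s <> 0) ->
  forall s0 eps, I s0 -> 0 < eps ->
  exists delta, 0 < delta /\
    forall y, Rabs (y - h s0) < delta -> exists s, I s /\ h s = y /\ Rabs (s - s0) < eps.
Proof.
  intros HI Hh Hn s0 eps Hs0 Heps.
  destruct (strict_monotone I h HI Hh Hn) as [c [c0 Hm]].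
  destruct HI as [HO [_ HI]].
  destruct (HO s0 Hs0) as [r Hr].
  (* [e] is small enough for the closed interval of radius [e] to lie in [I]. *)
  set (e := Rmin (r / 2) (eps / 2)).
  assert (He : 0 < e < r /\ e < eps).
  { destruct r as [r r0]; simpl in *. unfold e.
    generalize (Rmin_l (r / 2) (eps / 2)) (Rmin_r (r / 2) (eps / 2)).
    assert (0 < Rmin (r/2) (eps/2)) by (apply Rmin_glb_lt; lra). lra. }
  assert (HIn : forall s, Rabs (s - s0) <= e -> I s).
  { intros s Hs. apply Hr. change (Rabs (s - s0) < r). lra. }
  assert (Hl : I (s0 - e)) by (apply HIn; rewrite Rabs_left; lra).
  assert (Hu : I (s0 + e)) by (apply HIn; rewrite Rabs_right; lra).
  set (d1 := c * (h s0 - h (s0 - e))). set (d2 := c * (h (s0 + e) - h s0)).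
  assert (Hd1 : 0 < d1) by (apply Hm; auto; lra).
  assert (Hd2 : 0 < d2) by (apply Hm; auto; lra).
  assert (Hc : 0 < Rabs c) by (apply Rabs_pos_lt; exact c0).
  exists (Rmin d1 d2 / Rabs c). split.
  { apply Rdiv_lt_0_compat; [apply Rmin_glb_lt; lra|exact Hc]. }
  intros y Hy.
  assert (Hy' : Rabs (c * (y - h s0)) < Rmin d1 d2).
  { rewrite Rabs_mult. apply (Rmult_lt_compat_l (Rabs c)) in Hy; [|exact Hc].
    replace (Rabs c * (Rmin d1 d2 / Rabs c)) with (Rmin d1 d2) in Hy; [exact Hy|].
    field. lra. }
  apply Rabs_def2 in Hy'.
  generalize (Rmin_l d1 d2) (Rmin_r d1 d2). intros M1 M2.
  destruct (IVT_interv (fun s => c * (h s - y)) (s0 - e) (s0 + e)) as [z [Hz1 Hz2]].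
  - intros a Ha. apply (continuity_pt_scal (fun s => h s - y) c).
    apply (continuity_pt_minus h (fun _ => y)); [|apply continuity_pt_const; intros ? ?; reflexivity].
    apply derivable_continuous_pt, ex_derive_Reals_0, (smooth_ex_derive I); [assumption|].
    apply (HI (s0 - e) a (s0 + e)); assumption.
  - lra.
  - unfold d1 in *. lra.
  - unfold d2 in *. lra.
  - exists z. split; [apply (HI (s0 - e) z (s0 + e)); assumption|]. split.
    + apply Rmult_integral in Hz2. lra.
    + apply Rabs_def1; lra.
Qed.

Lemma injective_on (I : R -> Prop) (h : R -> R) :
  is_open_interval I -> smooth_on I h -> (forall s, I s -> Derive h s <> 0) ->
  forall s s', I s -> I s' -> h s = h s' -> s = s'.
Proof.
  intros HI Hh Hn s s' Hs Hs' E.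
  destruct (strict_monotone I h HI Hh Hn) as [c [c0 Hm]].
  destruct (Rtotal_order s s') as [L|[L|L]]; [|exact L|].
  - specialize (Hm s s' Hs Hs' L). rewrite E in Hm. lra.
  - specialize (Hm s' s Hs' Hs L). rewrite E in Hm. lra.
Qed.

Lemma image_open_interval (I : R -> Prop) (h : R -> R) :
  is_open_interval I -> smooth_on I h -> (forall s, I s -> Derive h s <> 0) ->
  is_open_interval (fun x => exists s, I s /\ h s = x).
Proof.
  intros HI Hh Hn. split; [|split].
  - intros x [s [Hs <-]].
    destruct (local_inverse I h HI Hh Hn s 1 Hs Rlt_0_1) as [d [d0 Hd]].
    exists (mkposreal d d0). intros y Hy. destruct (Hd y Hy) as [u [Hu [E _]]]. eauto.
  - destruct HI as [_ [[t Ht] _]]. exists (h t), t. auto.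
  - intros x y z [s [Hs <-]] [s' [Hs' <-]] Hy.
    destruct (Req_dec (h s) y) as [<-|N1]; [eauto|].
    destruct (Req_dec (h s') y) as [<-|N2]; [eauto|].
    destruct HI as [_ [_ HI]].
    assert (Hcont : forall u c, I u -> continuity_pt (fun v => c * (h v - y)) u).
    { intros u c Hu. apply (continuity_pt_scal (fun s => h s - y) c).
      apply (continuity_pt_minus h (fun _ => y)); [|apply continuity_pt_const; intros ? ?; reflexivity].
      apply derivable_continuous_pt, ex_derive_Reals_0, (smooth_ex_derive I); assumption. }
    destruct (Rtotal_order s s') as [L|[->|L]]; [|lra|].
    + destruct (IVT_interv (fun v => 1 * (h v - y)) s s') as [z [Hz1 Hz2]]; try lra.
      * intros a Ha. apply Hcont, (HI s a s'); assumption.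
      * exists z. split; [apply (HI s z s'); assumption|lra].
    + destruct (IVT_interv (fun v => (-1) * (h v - y)) s' s) as [z [Hz1 Hz2]]; try lra.
      * intros a Ha. apply Hcont, (HI s' a s); assumption.
      * exists z. split; [apply (HI s' z s); assumption|lra].
Qed.

(** The chain rule for [phi = psi o h^-1]. The function [psi - (d / h' s0) h] has
    derivative [0] at [s0], so it is small compared with [s - s0], and [s - s0] is
    at most [2 / |h' s0|] times [h s - h s0] near [s0]. *)
Lemma is_derive_reparam (I : R -> Prop) (h phi psi : R -> R) :
  is_open_interval I -> smooth_on I h -> (forall s, I s -> Derive h s <> 0) ->
  (forall s, I s -> phi (h s) = psi s) ->
  forall s d, I s -> is_derive psi s d -> is_derive phi (h s) (d / Derive h s).
Proof.
  intros HI Hh Hn Hphi s0 d Hs0 Hpsi.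
  set (k := Derive h s0). assert (k0 : k <> 0) by (apply Hn, Hs0).
  assert (Hk : 0 < Rabs k) by (apply Rabs_pos_lt, k0).
  assert (Dh : is_derive h s0 k) by (apply Derive_correct, (smooth_ex_derive I); assumption).
  assert (DF : is_derive (fun s => psi s - d / k * h s) s0 0).
  { replace 0 with (d - d / k * k) by (field; exact k0).
    apply @is_derive_minus; [exact Hpsi|]. apply is_derive_scal. exact Dh. }
  apply is_derive_Reals. intros eps Heps.
  apply is_derive_Reals in DF. apply is_derive_Reals in Dh.
  destruct (DF (eps * (Rabs k / 2))) as [r1 H1]; [apply Rmult_lt_0_compat; lra|].
  destruct (Dh (Rabs k / 2)) as [r2 H2]; [lra|].
  destruct (local_inverse I h HI Hh Hn s0 (Rmin r1 r2) Hs0) as [delta [delta0 Hd]].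
  { apply Rmin_glb_lt; apply cond_pos. }
  exists (mkposreal delta delta0). intros y y0 Hy. simpl in Hy.
  destruct (Hd (h s0 + y)) as [s [Hs [E Hss]]].
  { replace (h s0 + y - h s0) with y by ring. exact Hy. }
  set (e := s - s0) in Hss. assert (Es : s = s0 + e) by (unfold e; ring).
  assert (e0 : e <> 0).
  { intros e0. rewrite Es, e0, Rplus_0_r in E. lra. }
  specialize (H1 e e0 (Rlt_le_trans _ _ _ Hss (Rmin_l _ _))).
  specialize (H2 e e0 (Rlt_le_trans _ _ _ Hss (Rmin_r _ _))).
  rewrite <- Es, E in H1, H2.
  rewrite <- E, (Hphi s Hs), (Hphi s0 Hs0).
  replace (psi s - d / k * (h s0 + y) - (psi s0 - d / k * h s0))
    with (psi s - psi s0 - d / k * y) in H1 by ring.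
  replace (h s0 + y - h s0) with y in H2 by ring.
  assert (Hq : Rabs k / 2 < Rabs (y / e)).
  { assert (Rabs k <= Rabs (y / e) + Rabs (y / e - k)); [|lra].
    replace k with (y / e - (y / e - k)) at 1 by ring.
    unfold Rminus at 1. eapply Rle_trans; [apply Rabs_triang|]. rewrite Rabs_Ropp. lra. }
  replace ((psi s - psi s0 - d / k * y) / e - 0)
    with (((psi s - psi s0) / y - d / k) * (y / e)) in H1 by (field; auto).
  rewrite Rabs_mult in H1.
  assert (Hpos : 0 <= Rabs ((psi s - psi s0) / y - d / k)) by apply Rabs_pos.
  destruct (Rlt_or_le (Rabs ((psi s - psi s0) / y - d / k)) eps) as [H|H]; [exact H|exfalso].
  assert (eps * (Rabs k / 2) <= Rabs ((psi s - psi s0) / y - d / k) * Rabs (y / e)).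
  { apply Rmult_le_compat; lra. }
  lra.
Qed.

(** The class of all [phi] whose composition with [h] is smooth is closed under
    derivation, because [phi' o h = psi' / h'] is again smooth; [smooth_coind]
    applies to that class. *)
Lemma smooth_reparam (I : R -> Prop) (h phi psi : R -> R) :
  is_open_interval I -> smooth_on I h -> (forall s, I s -> Derive h s <> 0) ->
  smooth_on I psi -> (forall s, I s -> phi (h s) = psi s) ->
  smooth_on (fun x => exists s, I s /\ h s = x) phi.
Proof.
  intros HI Hh Hn Hpsi Hphi.
  apply (smooth_coind _ (fun phi => exists psi, smooth_on I psi /\
                                    forall s, I s -> phi (h s) = psi s)).
  - apply image_open_interval; assumption.
  - clear phi psi Hpsi Hphi. intros phi [psi [Hpsi Hphi]].
    exists (Derive phi). split.
    + exists (fun s => Derive psi s * / Derive h s). split.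
      * apply smooth_algebra_smooth; [apply HI|]. apply sa_mult; [now apply sa_base, smooth_derive|].
        apply sa_inv; [now apply sa_base, smooth_derive|exact Hn].
      * intros s Hs. apply is_derive_unique.
        apply (is_derive_reparam I h phi psi); auto.
        apply Derive_correct, (smooth_ex_derive I); assumption.
    + intros x [s [Hs <-]]. apply Derive_correct. eexists.
      apply (is_derive_reparam I h phi psi); eauto.
      apply Derive_correct, (smooth_ex_derive I); assumption.
  - exists psi. auto.
Qed.

Lemma graph_reparam (I : R -> Prop) (x z : R -> R) :
  is_open_interval I -> smooth_on I x -> (forall s, I s -> Derive x s <> 0) ->
  smooth_on I z ->
  exists (I' : R -> Prop) (f : R -> R),
    is_open_interval I' /\ smooth_on I' f /\ diffeo I I' x /\
    (forall s, I s -> f (x s) = z s /\ Derive f (x s) = Derive z s / Derive x s).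
Proof.
  intros HI Hx Hn Hz.
  set (inv := fun y => epsilon (inhabits 0) (fun s => I s /\ x s = y)).
  assert (Hf : forall s, I s -> z (inv (x s)) = z s).
  { intros s Hs. f_equal.
    destruct (epsilon_spec (inhabits 0) (fun u => I u /\ x u = x s)) as [H1 H2]; [eauto|].
    apply (injective_on I x); assumption. }
  exists (fun y => exists s, I s /\ x s = y), (fun y => z (inv y)).
  split; [now apply image_open_interval|].
  split; [now apply (smooth_reparam I x _ z)|].
  split; [split; [exact Hx|split; [exact Hn|reflexivity]]|].
  intros s Hs. split; [auto|]. apply is_derive_unique.
  apply (is_derive_reparam I x _ z); auto.
  apply Derive_correct, (smooth_ex_derive I); assumption.
Qed.

(** * The rapidity of a unit-speed planar curve *)

Lemma tanh_half_ln u v : 0 < v * v -> u * v = 1 ->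
  tanh (/ 2 * ln (v * v)) = (v - u) / (v + u).
Proof.
  intros Hv E. assert (v0 : v <> 0) by (intros ->; lra).
  set (w := exp (/ 2 * ln (v * v))).
  assert (Hw : 0 < w) by apply exp_pos.
  assert (Hww : w * w = v * v).
  { unfold w. rewrite <- exp_plus.
    replace (/ 2 * ln (v * v) + / 2 * ln (v * v)) with (ln (v * v)) by field.
    now apply exp_ln. }
  unfold tanh, sinh, cosh. rewrite exp_Ropp. fold w.
  replace u with (/ v) by (field_simplify_eq; [lra|exact v0]).
  replace ((w - / w) / 2 / ((w + / w) / 2)) with ((w * w - 1) / (w * w + 1)).
  - rewrite Hww. field; repeat split; try exact v0; nra.
  - field; repeat split; nra.
Qed.

(** The eta-expanded form in which [auto_derive] leaves derivatives. *)
Lemma derive_eta (f : R -> R) (s d : R) :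
  is_derive f s d -> Derive (fun u : R => f u) s = d.
Proof. exact (is_derive_unique f s d). Qed.

(** On the unit hyperbola [x1^2 - z1^2 = 1] the rapidity
    [artanh (z1 / x1) = ln |x1 + z1|] has derivative [x1 z2 - z1 x2]. When that is a
    linear form in the velocity, it integrates to the same linear form in the
    position, and [a] is the constant of integration. The rapidity is written
    [(1/2) ln ((x1 + z1)^2)] so that both signs of [x1] are covered. *)
Lemma profile_first_integral (I : R -> Prop) (x z x1 z1 x2 z2 : R -> R) (p q : R) :
  is_open_interval I ->
  (forall s, I s -> is_derive x s (x1 s) /\ is_derive z s (z1 s)) ->
  (forall s, I s -> is_derive x1 s (x2 s) /\ is_derive z1 s (z2 s)) ->
  (forall s, I s -> x1 s ^ 2 - z1 s ^ 2 = 1) ->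
  (forall s, I s -> x1 s * z2 s - z1 s * x2 s = p * x1 s + q * z1 s) ->
  exists a, forall s, I s -> z1 s / x1 s = tanh (p * x s + q * z s + a).
Proof.
  intros HI D1 D2 HE HK.
  set (v := fun s => x1 s + z1 s).
  assert (Huv : forall s, I s -> (x1 s - z1 s) * v s = 1) by (intros s Hs; unfold v; rewrite <- (HE s Hs); ring).
  assert (Hv : forall s, I s -> 0 < v s * v s).
  { intros s Hs. specialize (Huv s Hs). assert (v s <> 0) by (intros E; rewrite E in Huv; lra). nra. }
  assert (Hconst : forall s, I s ->
    is_derive (fun s => / 2 * ln (v s * v s) - (p * x s + q * z s)) s 0).
  { intros s Hs. destruct (D1 s Hs) as [Dx Dz], (D2 s Hs) as [Dx1 Dz1].
    specialize (Hv s Hs). specialize (Huv s Hs).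
    assert (v0 : v s <> 0) by (intros E; rewrite E in Hv; lra).
    assert (Dv : is_derive v s (x2 s + z2 s)) by (apply @is_derive_plus; assumption).
    auto_derive.
    - repeat split; try (eexists; eassumption). exact Hv.
    - rewrite (derive_eta v _ _ Dv), (derive_eta x _ _ Dx), (derive_eta z _ _ Dz).
      specialize (HK s Hs).
      rewrite !Rmult_1_l. rewrite <- HK.
      (* The derivative of [x1^2 - z1^2 = 1]; with it, [v' = v (x1 z2 - z1 x2)]. *)
      assert (Hor : x1 s * x2 s = z1 s * z2 s).
      { assert (E : is_derive (fun s => x1 s ^ 2 - z1 s ^ 2) s (2 * (x1 s * x2 s - z1 s * z2 s))).
        { auto_derive; [repeat split; eexists; eassumption|].
          rewrite (derive_eta x1 _ _ Dx1), (derive_eta z1 _ _ Dz1). ring. }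
        assert (E0 : is_derive (fun s => x1 s ^ 2 - z1 s ^ 2) s 0).
        { apply (is_derive_ext_loc (fun _ => 1)); [|apply @is_derive_const].
          generalize (proj1 HI s Hs). apply filter_imp. intros u Hu. symmetry; auto. }
        apply is_derive_unique in E. apply is_derive_unique in E0. rewrite E in E0. lra. }
      specialize (HE s Hs).
      assert (Ev : x2 s + z2 s = v s * (x1 s * z2 s - z1 s * x2 s))
        by (transitivity ((x2 s + z2 s) * (x1 s ^ 2 - z1 s ^ 2)
                       - v s * (x1 s * x2 s - z1 s * z2 s));
         [rewrite HE, Hor; ring|unfold v; ring]).
      rewrite Ev. field. exact v0. }
  destruct (proj1 (proj2 HI)) as [s0 Hs0].
  exists (/ 2 * ln (v s0 * v s0) - (p * x s0 + q * z s0)). intros s Hs.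
  assert (E := is_derive_zero_const I _ HI Hconst s s0 Hs Hs0). simpl in E.
  rewrite <- E.
  replace (p * x s + q * z s + (/ 2 * ln (v s * v s) - (p * x s + q * z s))) with (/2 * ln (v s * v s)) by ring.
  rewrite (tanh_half_ln (x1 s - z1 s)); auto. unfold v. field.
  split; [|specialize (HE s Hs); intros E1; rewrite E1 in HE; nra].
  specialize (HE s Hs). intros E1. assert (x1 s = 0) by lra. nra.
Qed.

(** * Lorentzian linear algebra *)

Definition det3 (u v w : L3) : R := lor (lcross u v) w.

Ltac coords :=
  repeat match goal with v : L3 |- _ => destruct v as [[? ?] ?] end;
  unfold det3, lor, lcross, vadd, vscal, vzero, cx, cy, cz in *; simpl in *.

Lemma L3_eq (u v : L3) : cx u = cx v -> cy u = cy v -> cz u = cz v -> u = v.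
Proof. coords. intros -> -> ->. reflexivity. Qed.

Lemma lor_nondegenerate (n : L3) : (forall v, lor n v = 0) -> n = vzero.
Proof.
  intros H. generalize (H (1, 0, 0)) (H (0, 1, 0)) (H (0, 0, 1)). clear H.
  intros H1 H2 H3. apply L3_eq; coords; lra.
Qed.

Lemma lor_lcross_lcross (u v u' v' : L3) :
  lor (lcross u v) (lcross u' v') = lor u v' * lor v u' - lor u u' * lor v v'.
Proof. coords. ring. Qed.

(** The Gram determinant, negated because the metric has determinant [-1]. *)
Lemma det3_sqr (u v w : L3) :
  det3 u v w ^ 2 =
  - (lor u u * (lor v v * lor w w - lor v w ^ 2)
     - lor u v * (lor u v * lor w w - lor v w * lor u w)
     + lor u w * (lor u v * lor v w - lor v v * lor u w)).
Proof. coords. ring. Qed.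

Lemma orthogonal_to_basis (u v w p : L3) :
  det3 u v w <> 0 -> lor p u = 0 -> lor p v = 0 -> lor p w = 0 -> p = vzero.
Proof.
  intros D Hu Hv Hw.
  assert (E : vscal (det3 u v w) p =
    vadd (vscal (lor p u) (lcross v w))
         (vadd (vscal (lor p v) (lcross w u)) (vscal (lor p w) (lcross u v)))).
  { apply L3_eq; coords; ring. }
  rewrite Hu, Hv, Hw in E.
  assert (Hz : forall x, det3 u v w * x = 0 -> x = 0).
  { intros x Hx. apply Rmult_integral in Hx. tauto. }
  apply L3_eq; apply Hz; [generalize (f_equal cx E)|generalize (f_equal cy E)|generalize (f_equal cz E)];
    unfold vscal, vadd, cx, cy, cz; simpl; intros ->; ring.
Qed.

(** The reversed Cauchy-Schwarz inequality. *)
Lemma timelike_lightlike_not_orthogonal (c l : L3) :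
  timelike c -> lightlike l -> lor c l <> 0.
Proof.
  intros Hc [Hl l0] E. unfold timelike in Hc.
  destruct c as [[c1 c2] c3], l as [[l1 l2] l3]. unfold lor, cx, cy, cz in *; simpl in *.
  assert (H3 : l3 <> 0).
  { intros H3. apply l0. subst l3.
    assert (l1 = 0) by nra. assert (l2 = 0) by nra. subst. reflexivity. }
  assert (0 < l3 * l3) by nra.
  assert (CS : (c1 * l1 + c2 * l2) ^ 2 <= (c1 * c1 + c2 * c2) * (l1 * l1 + l2 * l2)).
  { generalize (pow2_ge_0 (c1 * l2 - c2 * l1)). nra. }
  replace (c1 * l1 + c2 * l2) with (c3 * l3) in CS by lra.
  replace (l1 * l1 + l2 * l2) with (l3 * l3) in CS by lra.
  nra.
Qed.

Lemma lightlike_cz (l : L3) : lightlike l -> cz l <> 0.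
Proof.
  intros H. assert (T : timelike (0, 0, 1)) by (unfold timelike; coords; lra).
  intros E. apply (timelike_lightlike_not_orthogonal _ _ T H).
  unfold lor. rewrite E. unfold cx, cy, cz; simpl. ring.
Qed.

(** In the Lorentzian plane orthogonal to [u], the vectors orthogonal to a null
    vector [v] are its multiples. Indeed [lcross v w] is parallel to [u], since both
    [v] and [w] are orthogonal to [u], and it is null by the Lagrange identity;
    as [u] is not null, it vanishes. *)
Lemma null_orthogonal_parallel (u v w : L3) :
  lor u u = 1 -> lor u v = 0 -> lor u w = 0 -> lor v v = 0 -> lor v w = 0 ->
  lcross v w = vzero.
Proof.
  intros Huu Huv Huw Hvv Hvw.
  assert (Ec : vscal (lor u u) (lcross v w) =
    vadd (vscal (lor u (lcross v w)) u)
      (vadd (vscal (lor u v) (lcross u w)) (vscal (- lor u w) (lcross u v)))).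
  { apply L3_eq; coords; ring. }
  assert (En : lor (lcross v w) (lcross v w) = 0).
  { rewrite lor_lcross_lcross, Hvv, Hvw. ring. }
  rewrite Huu, Huv, Huw in Ec.
  set (k := lor u (lcross v w)) in *.
  assert (Ek : lcross v w = vscal k u).
  { apply L3_eq;
      [generalize (f_equal cx Ec)|generalize (f_equal cy Ec)|generalize (f_equal cz Ec)];
      unfold vscal, vadd, cx, cy, cz; simpl; intros H; lra. }
  rewrite Ek in En |- *.
  assert (k * k * lor u u = 0) by (rewrite <- En; clear; coords; ring).
  rewrite Huu in H. assert (k = 0) by nra. rewrite H0. clear. apply L3_eq; coords; ring.
Qed.

(** * Curves *)

Definition is_vderive (c : R -> L3) (t : R) (v : L3) : Prop :=
  is_derive (fun u => cx (c u)) t (cx v) /\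
  is_derive (fun u => cy (c u)) t (cy v) /\
  is_derive (fun u => cz (c u)) t (cz v).

Lemma is_vderive_unique c t v : is_vderive c t v -> vderiv c t = v.
Proof.
  intros (H1 & H2 & H3). apply L3_eq; [exact (is_derive_unique _ _ _ H1)
  |exact (is_derive_unique _ _ _ H2)|exact (is_derive_unique _ _ _ H3)].
Qed.

Lemma smooth_is_vderive I c t : smooth_curve I c -> I t -> is_vderive c t (vderiv c t).
Proof.
  intros (H1 & H2 & H3) Ht.
  split; [|split]; apply Derive_correct; eapply smooth_ex_derive; eassumption.
Qed.

Lemma smooth_vderiv I c : smooth_curve I c -> smooth_curve I (vderiv c).
Proof.
  intros (H1 & H2 & H3).
  split; [|split];
    [exact (smooth_derive _ _ H1)|exact (smooth_derive _ _ H2)|exact (smooth_derive _ _ H3)].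
Qed.

Lemma is_vderive_const v t : is_vderive (fun _ => v) t vzero.
Proof. split; [|split]; apply @is_derive_const. Qed.

Lemma is_derive_eq (f : R -> R) t d d' :
  is_derive f t d -> d = d' -> is_derive f t d'.
Proof. intros H <-. exact H. Qed.

Lemma is_derive_minus_R (f g : R -> R) t f' g' :
  is_derive f t f' -> is_derive g t g' -> is_derive (fun u => f u - g u) t (f' - g').
Proof. intros Hf Hg. exact (is_derive_minus f g t f' g' Hf Hg). Qed.

Lemma is_derive_opp_R (f : R -> R) t f' :
  is_derive f t f' -> is_derive (fun u => - f u) t (- f').
Proof. exact (is_derive_opp f t f'). Qed.

Lemma is_derive_mult_R (f g : R -> R) t f' g' :
  is_derive f t f' -> is_derive g t g' ->
  is_derive (fun u => f u * g u) t (f' * g t + f t * g').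
Proof. intros Hf Hg. apply @is_derive_mult; auto. intros; apply Rmult_comm. Qed.

Lemma is_derive_lor u v t u' v' :
  is_vderive u t u' -> is_vderive v t v' ->
  is_derive (fun s => lor (u s) (v s)) t (lor u' (v t) + lor (u t) v').
Proof.
  intros (U1 & U2 & U3) (V1 & V2 & V3). unfold lor.
  replace (_ + _) with
    (cx u' * cx (v t) + cx (u t) * cx v' + (cy u' * cy (v t) + cy (u t) * cy v')
     - (cz u' * cz (v t) + cz (u t) * cz v')) by ring.
  apply @is_derive_minus; [apply @is_derive_plus|];
    apply (is_derive_mult_R (fun s => _) (fun s => _)); assumption.
Qed.

Lemma is_vderive_lcross u v t u' v' :
  is_vderive u t u' -> is_vderive v t v' ->
  is_vderive (fun s => lcross (u s) (v s)) t (vadd (lcross u' (v t)) (lcross (u t) v')).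
Proof.
  intros (U1 & U2 & U3) (V1 & V2 & V3).
  split; [|split]; (eapply is_derive_eq;
    [lazymatch goal with
     | |- is_derive (fun s => cz _) _ _ => apply is_derive_opp_R, is_derive_minus_R
     | _ => apply is_derive_minus_R
     end; apply (is_derive_mult_R (fun s => _) (fun s => _)); eassumption
    |clear; unfold vadd, lcross; simpl; unfold cx, cy, cz; simpl; ring]).
Qed.

Lemma is_derive_const_on (I : R -> Prop) (f : R -> R) t d c :
  open I -> I t -> (forall s, I s -> f s = c) -> is_derive f t d -> d = 0.
Proof.
  intros HI Ht Hf Hd.
  assert (E : is_derive f t 0).
  { apply (is_derive_ext_loc (fun _ => c)); [|apply @is_derive_const].
    generalize (HI t Ht). apply filter_imp. intros u Hu. symmetry; auto. }
  apply is_derive_unique in E. apply is_derive_unique in Hd. congruence.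
Qed.

Lemma lor_const_on (I : R -> Prop) u v t u' v' c :
  open I -> I t -> (forall s, I s -> lor (u s) (v s) = c) ->
  is_vderive u t u' -> is_vderive v t v' -> lor u' (v t) + lor (u t) v' = 0.
Proof.
  intros HI Ht Hc Hu Hv.
  exact (is_derive_const_on I _ t _ c HI Ht Hc (is_derive_lor u v t u' v' Hu Hv)).
Qed.

Lemma arc_length_orthogonal I c :
  open I -> smooth_curve I c -> arc_length I c ->
  forall t, I t -> lor (vderiv c t) (vderiv2 c t) = 0.
Proof.
  intros HI Hc Ha t Ht.
  assert (D := smooth_is_vderive _ _ _ (smooth_vderiv _ _ Hc) Ht).
  assert (E := lor_const_on I _ _ t _ _ 1 HI Ht Ha D D).
  change (vderiv (vderiv c) t) with (vderiv2 c t) in E.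
  revert E. generalize (vderiv c t) (vderiv2 c t). intros u v. coords. lra.
Qed.

Lemma vderiv_zero_const (I : R -> Prop) (c : R -> L3) :
  is_open_interval I -> (forall t, I t -> is_vderive c t vzero) ->
  exists v, forall t, I t -> c t = v.
Proof.
  intros HI H. destruct (proj1 (proj2 HI)) as [t0 Ht0]. exists (c t0). intros t Ht.
  apply L3_eq; [apply (is_derive_zero_const I (fun u => cx (c u)))
               |apply (is_derive_zero_const I (fun u => cy (c u)))
               |apply (is_derive_zero_const I (fun u => cz (c u)))]; auto; intros; apply H; auto.
Qed.

Lemma planar_of_normal (I : R -> Prop) (c : R -> L3) (n : L3) :
  is_open_interval I -> smooth_curve I c -> n <> vzero ->
  (forall t, I t -> lor n (vderiv c t) = 0) -> planar I c.
Proof.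
  intros HI Hc n0 Hn. destruct (proj1 (proj2 HI)) as [t0 Ht0].
  exists (fun p => lor n p = lor n (c t0)). split.
  - exists (cx n), (cy n), (- cz n), (lor n (c t0)). split.
    + intros E. apply n0. injection E. clear. coords. intros.
      f_equal; [f_equal|]; lra.
    + intros p. unfold lor. split; intros; lra.
  - intros t Ht. apply (is_derive_zero_const I (fun u => lor n (c u))); auto.
    intros s Hs. replace 0 with (lor vzero (c s) + lor n (vderiv c s)).
    + apply (is_derive_lor (fun _ => n) c); [apply is_vderive_const|].
      apply (smooth_is_vderive I); auto.
    + rewrite Hn by exact Hs. clear. generalize (c s). intros v. coords. ring.
Qed.

Lemma planar_normal (I : R -> Prop) (c : R -> L3) :
  is_open_interval I -> smooth_curve I c -> planar I c ->
  exists n, n <> vzero /\ forall t, I t -> lor n (vderiv c t) = 0.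
Proof.
  intros HI Hc [P [[a [b [d [e [H0 HP]]]]] Hin]].
  exists (a, b, - d). split.
  { intros E. apply H0. injection E. intros. unfold vzero. f_equal; [f_equal|]; lra. }
  intros t Ht.
  assert (E : lor vzero (c t) + lor (a, b, - d) (vderiv c t) = 0).
  { apply (lor_const_on I (fun _ => (a, b, - d)) c t vzero (vderiv c t) e).
    - apply HI.
    - exact Ht.
    - intros s Hs. specialize (proj1 (HP _) (Hin s Hs)). unfold lor, cx, cy, cz. simpl. lra.
    - apply is_vderive_const.
    - apply (smooth_is_vderive I); auto. }
  rewrite <- E. generalize (c t) (vderiv c t). intros u v. coords. ring.
Qed.

(** * Pseudo-null curves *)

(** Differentiating [<b',b'> = 1] and [<b'',b''> = 0] shows that [b''] and [b''']
    are orthogonal to [b'] and to [b'']; hence [b'''] is a multiple of the null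
    vector [b''], whose direction [L] is therefore constant. Geometrically, [b']
    moves on a line of the ruled quadric [<v,v> = 1]. *)
Lemma pseudo_null_ruling (J : R -> Prop) (beta : R -> L3) :
  is_open_interval J -> pseudo_null J beta ->
  exists (W L : L3) (G g : R -> R),
    lor W W = 1 /\ lor W L = 0 /\ lightlike L /\
    forall t, J t ->
      vderiv beta t = vadd W (vscal (G t) L) /\
      vderiv2 beta t = vscal (g t) L /\
      is_derive G t (g t) /\ g t <> 0.
Proof.
  intros HJ (Hs & _ & H11 & Hl).
  set (b1 := vderiv beta) in *. set (b2 := vderiv2 beta) in *. set (b3 := vderiv b2).
  assert (D1 : forall t, J t -> is_vderive b1 t (b2 t)).
  { intros t Ht. apply (smooth_is_vderive J); [now apply smooth_vderiv|exact Ht]. }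
  assert (D2 : forall t, J t -> is_vderive b2 t (b3 t)).
  { intros t Ht. apply (smooth_is_vderive J); [now do 2 apply smooth_vderiv|exact Ht]. }
  assert (H12 : forall t, J t -> lor (b1 t) (b2 t) = 0).
  { apply arc_length_orthogonal; [apply HJ|exact Hs|exact H11]. }
  assert (H22 : forall t, J t -> lor (b2 t) (b2 t) = 0) by (intros t Ht; apply (Hl t Ht)).
  assert (H13 : forall t, J t -> lor (b1 t) (b3 t) = 0).
  { intros t Ht.
    assert (E := lor_const_on J b1 b2 t _ _ 0 (proj1 HJ) Ht H12 (D1 t Ht) (D2 t Ht)).
    rewrite (H22 t Ht) in E. lra. }
  assert (H23 : forall t, J t -> lor (b2 t) (b3 t) = 0).
  { intros t Ht.
    assert (E := lor_const_on J b2 b2 t _ _ 0 (proj1 HJ) Ht H22 (D2 t Ht) (D2 t Ht)).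
    revert E. generalize (b2 t) (b3 t). intros u v. coords. lra. }
  assert (Hz : forall t, J t -> cz (b2 t) <> 0) by (intros t Ht; apply lightlike_cz, Hl, Ht).
  assert (Hpar : forall t, J t -> lcross (b2 t) (b3 t) = vzero).
  { intros t Ht. apply (null_orthogonal_parallel (b1 t)); auto. }
  destruct (proj1 (proj2 HJ)) as [t0 Ht0].
  set (L := b2 t0). set (W := b1 t0).
  set (g := fun t => cz (b2 t) / cz L). set (G := fun t => (cz (b1 t) - cz W) / cz L).
  assert (L0 : cz L <> 0) by (apply Hz, Ht0).
  assert (Hb2 : forall t, J t -> b2 t = vscal (g t) L).
  { intros t Ht.
    assert (Ex : cx (b2 t) / cz (b2 t) = cx (b2 t0) / cz (b2 t0)).
    { apply (is_derive_zero_const J (fun u => cx (b2 u) / cz (b2 u))); auto.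
      intros s Is. destruct (D2 s Is) as (X & _ & Z).
      replace 0 with ((cx (b3 s) * cz (b2 s) - cx (b2 s) * cz (b3 s)) / cz (b2 s) ^ 2).
      - apply (is_derive_div (fun u => cx (b2 u)) (fun u => cz (b2 u))); auto.
      - assert (E := f_equal cy (Hpar s Is)). specialize (Hz s Is). revert E Hz.
        generalize (b2 s) (b3 s). clear. intros u v E H. coords.
        replace (_ - _) with 0 by lra. field. exact H. }
    assert (Ey : cy (b2 t) / cz (b2 t) = cy (b2 t0) / cz (b2 t0)).
    { apply (is_derive_zero_const J (fun u => cy (b2 u) / cz (b2 u))); auto.
      intros s Is. destruct (D2 s Is) as (_ & Y & Z).
      replace 0 with ((cy (b3 s) * cz (b2 s) - cy (b2 s) * cz (b3 s)) / cz (b2 s) ^ 2).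
      - apply (is_derive_div (fun u => cy (b2 u)) (fun u => cz (b2 u))); auto.
      - assert (E := f_equal cx (Hpar s Is)). specialize (Hz s Is). revert E Hz.
        generalize (b2 s) (b3 s). clear. intros u v E H. coords.
        replace (_ - _) with 0 by lra. field. exact H. }
    fold L in Ex, Ey. specialize (Hz t Ht). unfold g.
    apply L3_eq; unfold vscal; simpl.
    - change (cx (b2 t) = cz (b2 t) / cz L * cx L).
      transitivity (cx (b2 t) / cz (b2 t) * cz (b2 t)); [field; exact Hz|].
      rewrite Ex. field. exact L0.
    - change (cy (b2 t) = cz (b2 t) / cz L * cy L).
      transitivity (cy (b2 t) / cz (b2 t) * cz (b2 t)); [field; exact Hz|].
      rewrite Ey. field. exact L0.
    - change (cz (b2 t) = cz (b2 t) / cz L * cz L). field. exact L0. }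
  assert (DG : forall t, J t -> is_derive G t (g t)).
  { intros t Ht. destruct (D1 t Ht) as (_ & _ & Z). unfold G, g, Rdiv.
    replace (cz (b2 t) * / cz L) with ((cz (b2 t) - 0) * / cz L + (cz (b1 t) - cz W) * 0) by ring.
    apply (is_derive_mult_R (fun u => cz (b1 u) - cz W) (fun _ => / cz L)).
    - apply @is_derive_minus; [exact Z|apply @is_derive_const].
    - apply @is_derive_const. }
  assert (Hb1 : forall t, J t -> b1 t = vadd W (vscal (G t) L)).
  { assert (HG0 : G t0 = 0) by (unfold G, W; field; exact L0).
    assert (Hc : forall (p : L3 -> R),
      (forall t, J t -> is_derive (fun u => p (b1 u)) t (p (b2 t))) ->
      (forall a v, p (vscal a v) = a * p v) ->
      forall t, J t -> p (b1 t) = p W + G t * p L).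
    { intros p Dp Lp t Ht.
      assert (E : p (b1 t) - G t * p L = p (b1 t0) - G t0 * p L).
      { apply (is_derive_zero_const J (fun u => p (b1 u) - G u * p L)); auto.
        intros s Is. replace 0 with (p (b2 s) - (g s * p L + G s * 0)).
        - apply @is_derive_minus; [apply Dp, Is|].
          apply (is_derive_mult_R G (fun _ => p L)); [apply DG, Is|apply @is_derive_const].
        - rewrite (Hb2 s Is), Lp. ring. }
      rewrite HG0 in E. fold W in E. lra. }
    intros t Ht. apply L3_eq; [apply (Hc cx)|apply (Hc cy)|apply (Hc cz)]; auto;
      intros s Is; apply (D1 s Is). }
  exists W, L, G, g.
  split; [apply H11, Ht0|]. split; [apply H12, Ht0|]. split; [apply Hl, Ht0|].
  intros t Ht. split; [auto|]. split; [auto|]. split; [auto|].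
  apply Rmult_integral_contrapositive. split; [now apply Hz|now apply Rinv_neq_0_compat].
Qed.

(** * The maximal equation of a translation surface *)

Lemma Derive_shift (f : R -> R) c x : Derive (fun u => f u + c) x = Derive f x.
Proof.
  unfold Derive. f_equal. apply Lim_ext. intros h. f_equal. ring.
Qed.

Lemma Derive_shift_l (f : R -> R) c x : Derive (fun u => c + f u) x = Derive f x.
Proof.
  unfold Derive. f_equal. apply Lim_ext. intros h. f_equal. ring.
Qed.

Lemma vderiv_ext c d t : (forall u, c u = d u) -> vderiv c t = vderiv d t.
Proof.
  intros H. unfold vderiv. f_equal; [f_equal|]; apply Derive_ext; intros u; now rewrite H.
Qed.

Lemma vderiv_const v t : vderiv (fun _ => v) t = vzero.
Proof. apply is_vderive_unique, is_vderive_const. Qed.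

(** [Derive_shift] holds without differentiability, hence so does this, and it can
    be rewritten under a second derivative. *)
Lemma partial_s_translation alpha beta s t :
  partial_s (translation alpha beta) s t = vderiv alpha s.
Proof.
  apply L3_eq; [exact (Derive_shift (fun u => cx (alpha u)) _ s)
    |exact (Derive_shift (fun u => cy (alpha u)) _ s)
    |exact (Derive_shift (fun u => cz (alpha u)) _ s)].
Qed.

Lemma partial_t_translation alpha beta s t :
  partial_t (translation alpha beta) s t = vderiv beta t.
Proof.
  apply L3_eq; [exact (Derive_shift_l (fun u => cx (beta u)) _ t)
    |exact (Derive_shift_l (fun u => cy (beta u)) _ t)
    |exact (Derive_shift_l (fun u => cz (beta u)) _ t)].
Qed.

Lemma tangent_plane_spacelike I J alpha beta :
  arc_length I alpha -> arc_length J beta ->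
  spacelike_surface I J (translation alpha beta) ->
  forall s t, I s -> J t -> lor (vderiv alpha s) (vderiv beta t) ^ 2 < 1.
Proof.
  intros Ha Hb Hsp s t Hs Ht.
  set (F := lor (vderiv alpha s) (vderiv beta t)).
  assert (Hne : (- F, 1) <> (0, 0)) by (intros E; injection E; lra).
  (* [- F, 1] are the coordinates of the part of [b'] orthogonal to [a']. *)
  specialize (Hsp s t Hs Ht (- F) 1 Hne). unfold ffE, ffF, ffG in Hsp.
  rewrite partial_s_translation, partial_t_translation, (Ha s Hs), (Hb t Ht) in Hsp.
  fold F in Hsp. lra.
Qed.

(** Here [E = G = 1] and the mixed second derivative of a translation surface is
    zero, so [H = 0] reduces to [<a'' + b'', N> = 0], where [N] is a nonzero
    multiple of [lcross a' b']. *)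
Lemma maximal_translation_equation I J alpha beta :
  arc_length I alpha -> arc_length J beta ->
  maximal I J (translation alpha beta) ->
  forall s t, I s -> J t ->
    det3 (vderiv alpha s) (vderiv beta t) (vadd (vderiv2 alpha s) (vderiv2 beta t)) = 0.
Proof.
  intros Ha Hb [Hsp Hmean] s t Hs Ht.
  assert (HF := tangent_plane_spacelike I J alpha beta Ha Hb Hsp s t Hs Ht).
  specialize (Hmean s t Hs Ht).
  unfold mean_curvature, sfe, sff, sfg, unit_normal, ffE, ffF, ffG in Hmean.
  assert (Ess : partial_s (partial_s (translation alpha beta)) s t = vderiv2 alpha s)
    by (apply vderiv_ext; intros u; apply partial_s_translation).
  assert (Ets : partial_t (partial_s (translation alpha beta)) s t = vzero).
  { transitivity (vderiv (fun _ => vderiv alpha s) t); [|apply vderiv_const].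
    apply vderiv_ext. intros u. apply partial_s_translation. }
  assert (Ett : partial_t (partial_t (translation alpha beta)) s t = vderiv2 beta t)
    by (apply vderiv_ext; intros u; apply partial_t_translation).
  rewrite Ess, Ets, Ett, partial_s_translation, partial_t_translation, (Ha s Hs), (Hb t Ht) in Hmean.
  set (F := lor (vderiv alpha s) (vderiv beta t)) in *.
  set (k := / sqrt (1 * 1 - F ^ 2)) in *.
  assert (k0 : k <> 0) by (apply Rinv_neq_0_compat, Rgt_not_eq, sqrt_lt_R0; lra).
  assert (d0 : 2 * (1 * 1 - F ^ 2) <> 0) by lra.
  apply (Rmult_eq_compat_r (2 * (1 * 1 - F ^ 2))) in Hmean.
  unfold Rdiv in Hmean. rewrite Rmult_assoc, Rinv_l, Rmult_0_l, Rmult_1_r in Hmean by exact d0.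
  assert (E : k * det3 (vderiv alpha s) (vderiv beta t) (vadd (vderiv2 alpha s) (vderiv2 beta t)) = 0).
  { transitivity (- 0); [|ring]. rewrite <- Hmean. clear. generalize (vderiv alpha s) (vderiv beta t) (vderiv2 alpha s) (vderiv2 beta t).
    intros a b c d. coords. ring. }
  apply Rmult_integral in E. tauto.
Qed.

Lemma det3_ruling (a W L c : L3) (G g : R) :
  det3 a (vadd W (vscal G L)) (vadd c (vscal g L))
  = - lor (lcross a c) W - G * lor (lcross a c) L + g * det3 a W L.
Proof. coords. ring. Qed.

(** The determinant equals [<lcross a b, L>], and [lcross a b] is normal to a
    spacelike plane, hence timelike. *)
Lemma det3_ruling_ne (a b W L : L3) (G : R) :
  b = vadd W (vscal G L) -> lor a a = 1 -> lor b b = 1 -> lor a b ^ 2 < 1 -> lightlike L ->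
  det3 a W L <> 0.
Proof.
  intros Hb Haa Hbb Hab HL.
  replace (det3 a W L) with (lor (lcross a b) L) by (subst b; clear; coords; ring).
  apply timelike_lightlike_not_orthogonal; [|exact HL].
  unfold timelike. rewrite lor_lcross_lcross, Haa, Hbb.
  replace (lor b a) with (lor a b) by (clear; coords; ring). lra.
Qed.

(** For fixed [s] the relation is linear in [(P s, Q s)] with coefficients that
    depend on [t] alone; since [G] is not constant, two values of [t] determine
    [P s / u s] and [Q s / u s] independently of [s]. *)
Lemma affine_separation (I J : R -> Prop) (P Q u G g : R -> R) :
  is_open_interval J -> (forall t, J t -> is_derive G t (g t) /\ g t <> 0) ->
  (forall s t, I s -> J t -> P s + G t * Q s = g t * u s) ->
  exists A B, forall s, I s -> P s = A * u s /\ Q s = B * u s.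
Proof.
  intros HJ HG HE. destruct (proj1 (proj2 HJ)) as [t0 Ht0].
  assert (Hne : exists t1, J t1 /\ G t1 <> G t0).
  { apply NNPP. intros N. apply (proj2 (HG t0 Ht0)).
    apply (is_derive_const_on J G t0 _ (G t0)); [apply HJ|exact Ht0| |apply HG, Ht0].
    intros t Ht. apply NNPP. intros N'. apply N. eauto. }
  destruct Hne as [t1 [Ht1 Hne]].
  set (B := (g t1 - g t0) / (G t1 - G t0)).
  exists (g t0 - B * G t0), B. intros s Hs.
  assert (E0 := HE s t0 Hs Ht0). assert (E1 := HE s t1 Hs Ht1).
  assert (EQ : Q s = B * u s).
  { unfold B. apply (Rmult_eq_reg_l (G t1 - G t0)); [|lra].
    transitivity ((g t1 - g t0) * u s); [lra|field; lra]. }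
  split; [|exact EQ]. rewrite EQ in E0. lra.
Qed.

(** * Planarity of the first curve *)

(** Put [c = lcross a' a''] and [u = det3 a' W L]. The vector [n = c / u] is normal
    to [a'] and [a''], and by hypothesis its products with [W] and [L] are
    constant. So [n'] is orthogonal to [W] and [L], and also to [a'] because
    [<n',a'> = - <n,a''> = 0]. These three vectors are independent, so [n] is
    constant; it is nonzero because [<c,c> = - <a'',a''> > 0]. *)
Lemma constant_normal (I : R -> Prop) (alpha : R -> L3) (W L : L3) (A B : R) :
  is_open_interval I -> smooth_curve I alpha -> arc_length I alpha ->
  (forall s, I s -> timelike (vderiv2 alpha s)) ->
  (forall s, I s -> det3 (vderiv alpha s) W L <> 0) ->
  (forall s, I s ->
     lor (lcross (vderiv alpha s) (vderiv2 alpha s)) W = A * det3 (vderiv alpha s) W L /\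
     lor (lcross (vderiv alpha s) (vderiv2 alpha s)) L = B * det3 (vderiv alpha s) W L) ->
  planar I alpha.
Proof.
  intros HI Hs Ha Htl Hu HAB.
  set (a1 := vderiv alpha) in *. set (a2 := vderiv2 alpha) in *. set (a3 := vderiv a2).
  set (c := fun s => lcross (a1 s) (a2 s)). set (u := fun s => det3 (a1 s) W L) in *.
  set (c' := fun s => lcross (a1 s) (a3 s)). set (u' := fun s => det3 (a2 s) W L).
  assert (D1 : forall s, I s -> is_vderive a1 s (a2 s)).
  { intros s Is. apply (smooth_is_vderive I); [now apply smooth_vderiv|exact Is]. }
  assert (D2 : forall s, I s -> is_vderive a2 s (a3 s)).
  { intros s Is. apply (smooth_is_vderive I); [now do 2 apply smooth_vderiv|exact Is]. }
  assert (Dc : forall s, I s -> is_vderive c s (c' s)).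
  { intros s Is. replace (c' s) with (vadd (lcross (a2 s) (a2 s)) (lcross (a1 s) (a3 s))).
    - apply is_vderive_lcross; auto.
    - unfold c'. generalize (a1 s) (a2 s) (a3 s). clear. intros x y z.
      apply L3_eq; coords; ring. }
  assert (Du : forall s, I s -> is_derive u s (u' s)).
  { intros s Is.
    eapply is_derive_eq;
      [apply (is_derive_lor (fun s => lcross (a1 s) W) (fun _ => L));
         [apply (is_vderive_lcross a1 (fun _ => W)); [apply D1, Is|apply is_vderive_const]
         |apply is_vderive_const]|].
    unfold u'. generalize (a1 s) (a2 s). clear. intros x y. coords. ring. }
  (* This is [u^2 n']; the first two products come from differentiating
     [<c,V> = k u] for [V = W] and [V = L]. *)
  assert (Hpar : forall s, I s -> vadd (vscal (u s) (c' s)) (vscal (- u' s) (c s)) = vzero).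
  { intros s Is.
    assert (HV : forall V k, (forall r, I r -> lor (c r) V = k * u r) ->
              lor (vadd (vscal (u s) (c' s)) (vscal (- u' s) (c s))) V = 0).
    { intros V k HV.
      assert (E : lor (c' s) V - k * u' s = 0).
      { apply (is_derive_const_on I (fun r => lor (c r) V - k * u r) s _ 0);
          [apply HI|exact Is| |].
        - intros r Ir. rewrite (HV r Ir). ring.
        - apply is_derive_minus_R.
          + eapply is_derive_eq;
              [apply (is_derive_lor c (fun _ => V)); [apply Dc, Is|apply is_vderive_const]|].
            generalize (c s) (c' s). clear. intros x y. coords. ring.
          + apply is_derive_scal. apply Du, Is. }
      specialize (HV s Is).
      transitivity (u s * lor (c' s) V - u' s * lor (c s) V).
      - generalize (c s) (c' s) (u s) (u' s). clear. intros x y p q. coords. ring.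
      - rewrite HV. replace (lor (c' s) V) with (k * u' s) by lra. ring. }
    apply (orthogonal_to_basis (a1 s) W L); [apply Hu, Is| | |].
    - unfold c, c'. generalize (u s) (u' s) (a1 s) (a2 s) (a3 s). clear.
      intros p q x y z. coords. ring.
    - apply (HV W A). intros r Ir. apply HAB, Ir.
    - apply (HV L B). intros r Ir. apply HAB, Ir. }
  destruct (vderiv_zero_const I (fun s => vscal (/ u s) (c s)) HI) as [n Hn].
  { intros s Is. destruct (Dc s Is) as (Cx & Cy & Cz). specialize (Hpar s Is).
    assert (Di := is_derive_inv u s _ (Du s Is) (Hu s Is)).
    split; [|split]; (eapply is_derive_eq;
      [apply (is_derive_mult_R (fun s => / u s) (fun s => _)); eassumption|]);
      [apply (f_equal cx) in Hpar|apply (f_equal cy) in Hpar|apply (f_equal cz) in Hpar];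
      specialize (Hu s Is); fold (u s) in Hu; revert Hpar Hu;
      generalize (c s) (c' s) (u s) (u' s); clear; intros x y p q; coords; intros E Hp;
      (field_simplify_eq; [lra|exact Hp]). }
  destruct (proj1 (proj2 HI)) as [s0 Hs0].
  apply (planar_of_normal I alpha n); auto.
  - intros n0. rewrite <- (Hn s0 Hs0) in n0.
    assert (Hc : lor (c s0) (c s0) > 0).
    { unfold c. rewrite lor_lcross_lcross.
      assert (O := arc_length_orthogonal I alpha (proj1 HI) Hs Ha s0 Hs0).
      fold a1 a2 in O. specialize (Ha s0 Hs0). specialize (Htl s0 Hs0). unfold timelike in Htl.
      fold a1 in Ha. rewrite Ha, O. lra. }
    assert (E : c s0 = vzero).
    { transitivity (vscal (u s0) (vscal (/ u s0) (c s0))).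
      - specialize (Hu s0 Hs0). revert Hu. fold (u s0). generalize (c s0) (u s0).
        clear. intros x p Hp. apply L3_eq; coords; field; exact Hp.
      - rewrite n0. generalize (u s0). clear. intros p. apply L3_eq; coords; ring. }
    rewrite E in Hc. revert Hc. clear. coords. lra.
  - intros s Is. rewrite <- (Hn s Is). fold a1. unfold c.
    generalize (/ u s) (a1 s) (a2 s). clear. intros p x y. coords. ring.
Qed.

(** * Linear isometries and normal positions *)

Definition linear_isometry (Phi : L3 -> L3) : Prop :=
  linear_map Phi /\ forall u v, lor (Phi u) (Phi v) = lor u v.

Lemma linear_coordinates Phi v : linear_map Phi ->
  Phi v = vadd (vscal (cx v) (Phi (1, 0, 0)))
            (vadd (vscal (cy v) (Phi (0, 1, 0))) (vscal (cz v) (Phi (0, 0, 1)))).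
Proof.
  intros [Ha Hc]. rewrite <- !Hc, <- !Ha. f_equal. apply L3_eq; coords; ring.
Qed.

Lemma linear_isometry_comp Phi Psi :
  linear_isometry Phi -> linear_isometry Psi -> linear_isometry (fun v => Psi (Phi v)).
Proof.
  intros [[A1 S1] I1] [[A2 S2] I2]. split; [split|]; intros.
  - now rewrite A1, A2.
  - now rewrite S1, S2.
  - now rewrite I2, I1.
Qed.

(** The square of a determinant is a Gram determinant, so it is preserved. *)
Lemma linear_isometry_det3 Phi u v w : linear_isometry Phi ->
  det3 (Phi u) (Phi v) (Phi w) = 0 <-> det3 u v w = 0.
Proof.
  intros [_ H].
  assert (E : det3 (Phi u) (Phi v) (Phi w) ^ 2 = det3 u v w ^ 2) by (rewrite !det3_sqr, !H; ring).
  split; intros E0; rewrite E0 in E; nra.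
Qed.

Lemma linear_isometry_ne Phi v : linear_isometry Phi -> v <> vzero -> Phi v <> vzero.
Proof.
  intros [_ H] Hv E. apply Hv, lor_nondegenerate. intros u. rewrite <- H, E.
  generalize (Phi u). clear. intros x. coords. ring.
Qed.

Lemma is_vderive_linear Phi c t v : linear_map Phi ->
  is_vderive c t v -> is_vderive (fun u => Phi (c u)) t (Phi v).
Proof.
  intros HP (H1 & H2 & H3).
  assert (K : forall p : L3 -> R, (forall a u, p (vscal a u) = a * p u) ->
    (forall u w, p (vadd u w) = p u + p w) ->
    is_derive (fun u => p (Phi (c u))) t (p (Phi v))).
  { intros p Ps Pa.
    assert (E : forall u, p (Phi u) = cx u * p (Phi (1, 0, 0)) +
              (cy u * p (Phi (0, 1, 0)) + cz u * p (Phi (0, 0, 1)))).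
    { intros u. rewrite (linear_coordinates Phi u HP), !Pa, !Ps. reflexivity. }
    rewrite E. apply (is_derive_ext (fun u => cx (c u) * p (Phi (1, 0, 0)) +
              (cy (c u) * p (Phi (0, 1, 0)) + cz (c u) * p (Phi (0, 0, 1))))).
    { intros u. symmetry. apply E. }
    assert (M : forall f d k, is_derive f t d -> is_derive (fun u => f u * k) t (d * k)).
    { intros f d k Hf. eapply is_derive_eq;
        [apply (is_derive_mult_R f (fun _ => k)); [exact Hf|apply @is_derive_const]|].
      change (d * k + f t * 0 = d * k). ring. }
    apply @is_derive_plus; [|apply @is_derive_plus];
      [apply (M (fun u => cx (c u)))|apply (M (fun u => cy (c u)))|apply (M (fun u => cz (c u)))];
      assumption. }
  split; [|split]; apply K; intros; reflexivity.
Qed.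

Lemma smooth_on_ext I f g : (forall t, f t = g t) -> smooth_on I f -> smooth_on I g.
Proof. intros E H n t Ht. apply (ex_derive_n_ext f); auto. Qed.

Lemma smooth_linear I Phi c : open I -> linear_map Phi ->
  smooth_curve I c -> smooth_curve I (fun u => Phi (c u)).
Proof.
  intros HI HP (H1 & H2 & H3).
  assert (K : forall p : L3 -> R, (forall a u, p (vscal a u) = a * p u) ->
    (forall u w, p (vadd u w) = p u + p w) ->
    smooth_on I (fun u => p (Phi (c u)))).
  { intros p Ps Pa.
    apply (smooth_on_ext I (fun u => cx (c u) * p (Phi (1, 0, 0)) +
              (cy (c u) * p (Phi (0, 1, 0)) + cz (c u) * p (Phi (0, 0, 1))))).
    { intros u. rewrite (linear_coordinates Phi (c u) HP), !Pa, !Ps. reflexivity. }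
    apply smooth_algebra_smooth; [exact HI|].
    repeat apply sa_plus; apply sa_mult; (apply sa_const || apply sa_base; assumption). }
  split; [|split]; apply K; intros; reflexivity.
Qed.

(** Coordinates in the orthonormal frame [e], [lcross e e3], [e3], with [e3] the
    normalization of [tau]. The normal [n] is a multiple of the second vector. *)
Lemma adapted_isometry (e tau n : L3) :
  lor e e = 1 -> lor e tau = 0 -> timelike tau ->
  n <> vzero -> lor n e = 0 -> lor n tau = 0 ->
  exists Phi, linear_isometry Phi /\ forall v, lor n v = 0 -> cy (Phi v) = 0.
Proof.
  intros Hee Het Htt n0 Hne Hnt. unfold timelike in Htt.
  set (k := / sqrt (- lor tau tau)).
  assert (k2 : k ^ 2 * lor tau tau = - 1).
  { unfold k. rewrite pow_inv, <- Rsqr_pow2, Rsqr_sqrt by lra. field. lra. }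
  set (e3 := vscal k tau).
  assert (H33 : lor e3 e3 = -1).
  { rewrite <- k2. unfold e3. generalize k. clear. intros k. coords. ring. }
  assert (H13 : lor e e3 = 0).
  { transitivity (k * lor e tau); [|rewrite Het; ring].
    unfold e3. generalize k. clear. intros k. coords. ring. }
  assert (Hn3 : lor n e3 = 0).
  { transitivity (k * lor n tau); [|rewrite Hnt; ring].
    unfold e3. generalize k. clear. intros k. coords. ring. }
  clearbody e3. clear Het Htt Hnt k2. clear k.
  set (e2 := lcross e e3).
  (* The Gram determinant of [u], [e], [e3] against [v], [e], [e3]. *)
  assert (Hdec : forall u v, lor u v = lor u e * lor v e + lor u e2 * lor v e2 - lor u e3 * lor v e3).
  { intros u v.
    assert (Hg : lor u e2 * lor v e2 =
      - (lor u v * (lor e e * lor e3 e3 - lor e e3 ^ 2)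
         - lor u e * (lor v e * lor e3 e3 - lor e e3 * lor v e3)
         + lor u e3 * (lor v e * lor e e3 - lor e e * lor v e3))).
    { unfold e2. clear. coords. ring. }
    rewrite Hg, Hee, H33, H13. ring. }
  exists (fun v => (lor v e, lor v e2, lor v e3)). split; [split; [split|]|].
  - intros u v. clear. generalize e2. intros x. apply L3_eq; coords; ring.
  - intros c v. clear. generalize e2. intros x. apply L3_eq; coords; ring.
  - intros u v. rewrite (Hdec u v). unfold lor at 1, cx at 1 2, cy at 1 2, cz at 1 2. simpl. ring.
  - intros v Hv. change (lor v e2 = 0).
    assert (Hn2 : lor n e2 <> 0).
    { intros Hn2. apply n0, lor_nondegenerate. intros w.
      rewrite (Hdec n w), Hne, Hn2, Hn3. ring. }
    rewrite (Hdec n v), Hne, Hn3 in Hv.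
    assert (E : lor n e2 * lor v e2 = 0) by lra. apply Rmult_integral in E. tauto.
Qed.

Lemma sign_isometry (a b c : R) : a ^ 2 = 1 -> b ^ 2 = 1 -> c ^ 2 = 1 ->
  linear_isometry (fun v => (a * cx v, b * cy v, c * cz v)).
Proof.
  intros Ha Hb Hc. split; [split|].
  - intros u v. clear. apply L3_eq; coords; ring.
  - intros k v. clear. apply L3_eq; coords; ring.
  - intros u v.
    transitivity (a ^ 2 * (cx u * cx v) + b ^ 2 * (cy u * cy v) - c ^ 2 * (cz u * cz v)).
    + clear. coords. ring.
    + rewrite Ha, Hb, Hc. unfold lor. ring.
Qed.

Lemma cosh_sqr x : cosh x ^ 2 = 1 + sinh x ^ 2.
Proof.
  unfold cosh, sinh. rewrite exp_Ropp. field. apply Rgt_not_eq, exp_pos.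
Qed.

Lemma cosh_gt_0 x : 0 < cosh x.
Proof. unfold cosh. generalize (exp_pos x) (exp_pos (- x)). lra. Qed.

(** Reflections in the coordinate planes bring a unit vector [W] orthogonal to a
    null vector [L] to one of two positions relative to the plane [y = 0]. Either [L] lies
    in that plane, on one of its two null lines, or [L] is transversal to it. In
    the second case rescale the second coordinate of [L] to [1]; then
    [W - cy W L] lies in the plane and is a unit vector orthogonal to [L], which
    determines it up to sign. *)
Lemma normal_position (W L : L3) :
  lor W W = 1 -> lor W L = 0 -> lightlike L ->
  exists Sigma, linear_isometry Sigma /\ (forall v, cy v = 0 -> cy (Sigma v) = 0) /\
    ((exists l b, l <> 0 /\ Sigma L = vscal l (1, 0, 1) /\ Sigma W = (b, 1, b)) \/
     (exists l w theta, l <> 0 /\ Sigma L = vscal l (sinh theta, 1, cosh theta) /\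
        Sigma W = vadd (vscal w (sinh theta, 1, cosh theta))
                       (vscal (-1) (cosh theta, 0, sinh theta)))).
Proof.
  intros HWW HWL [HLL L0].
  destruct W as [[w1 w2] w3], L as [[l1 l2] l3].
  unfold lor, cx, cy, cz in HWW, HWL, HLL; simpl in *.
  destruct (Req_dec l2 0) as [->|Hl2].
  - assert (Hl1 : l1 <> 0).
    { intros ->. apply L0. assert (l3 = 0) by nra. subst. reflexivity. }
    assert (Hs : (l3 / l1) ^ 2 = 1) by (field_simplify_eq; [lra|exact Hl1]).
    assert (Hw3 : l3 / l1 * w3 = w1) by (field_simplify_eq; [lra|exact Hl1]).
    assert (Hl3 : l3 / l1 * l3 = l1) by (field_simplify_eq; [lra|exact Hl1]).
    assert (Hw2 : w2 * w2 = 1).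
    { assert (w1 * w1 = w3 * w3); [|lra]. rewrite <- Hw3. 
      transitivity ((l3 / l1) ^ 2 * (w3 * w3)); [ring|]. rewrite Hs. ring. }
    (* Both [w2] and [l3 / l1] are signs. *)
    exists (fun v => (1 * cx v, w2 * cy v, l3 / l1 * cz v)).
    split; [apply sign_isometry; lra|].
    split; [intros v Hv; change (w2 * cy v = 0); rewrite Hv; ring|].
    left. exists l1, w1. split; [exact Hl1|].
    split; apply L3_eq; unfold vscal, cx, cy, cz; simpl; lra.
  - set (p := l1 / l2). set (r := l3 / l2).
    assert (Hr : r ^ 2 = 1 + p ^ 2) by (unfold r, p; field_simplify_eq; [lra|exact Hl2]).
    assert (E1 : l1 = l2 * p) by (unfold p; field; exact Hl2).
    assert (E3 : l3 = l2 * r) by (unfold r; field; exact Hl2).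
    clearbody p r. subst l1 l3. clear L0 HLL.
    set (theta := arcsinh p). assert (Hp : sinh theta = p) by apply sinh_arcsinh.
    set (C := cosh theta). assert (HCe : cosh theta = C) by reflexivity. assert (HC : 0 < C) by apply cosh_gt_0.
    assert (HC2 : C ^ 2 = 1 + p ^ 2) by (unfold C; rewrite cosh_sqr, Hp; reflexivity).
    set (q := w1 - w2 * p). set (v := w3 - w2 * r).
    assert (Ew1 : w1 = q + w2 * p) by (unfold q; ring).
    assert (Ew3 : w3 = v + w2 * r) by (unfold v; ring).
    clearbody q v C theta. subst w1 w3.
    assert (Hqp : q * p = v * r).
    { apply (Rmult_eq_reg_l l2); [|exact Hl2].
      assert (l2 * w2 * r ^ 2 = l2 * w2 * (1 + p ^ 2)) by (rewrite Hr; ring). lra. }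
    assert (Hqv : q ^ 2 = 1 + v ^ 2).
    { assert (w2 ^ 2 * r ^ 2 = w2 ^ 2 * (1 + p ^ 2)) by (rewrite Hr; ring).
      assert (w2 * (q * p) = w2 * (v * r)) by (rewrite Hqp; ring). lra. }
    assert (Hq : q ^ 2 = C ^ 2).
    (* Multiply [q^2 = 1 + v^2] by [r^2] and use [q p = v r]. *)
    { assert (q ^ 2 * r ^ 2 = r ^ 2 + q ^ 2 * p ^ 2).
      { transitivity ((1 + v ^ 2) * r ^ 2); [rewrite Hqv; ring|].
        replace (q ^ 2 * p ^ 2) with ((v * r) ^ 2) by (rewrite <- Hqp; ring). ring. }
      rewrite Hr in H. nra. }
    (* [rho] makes the last coordinate of [L] positive; [d] is the sign for which
       [W - cy W L] becomes [- (cosh theta, 0, sinh theta)]. *)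
    set (rho := r / C). set (d := - q / C).
    assert (Hrho : rho ^ 2 = 1) by (unfold rho; field_simplify_eq; [lra|lra]).
    assert (Hd : d ^ 2 = 1) by (unfold d; field_simplify_eq; [lra|lra]).
    assert (Er : r = rho * C) by (unfold rho; field; lra).
    assert (Eq : q = - d * C) by (unfold d; field; lra).
    clearbody rho d. subst r q.
    assert (Ev : v = - d * rho * p).
    { assert (- d * p = v * rho) by (apply (Rmult_eq_reg_r C); lra).
      transitivity (rho ^ 2 * v); [rewrite Hrho; ring|].
      transitivity (rho * (v * rho)); [ring|]. rewrite <- H. ring. }
    subst v.
    exists (fun v => (d * cx v, d * cy v, d * rho * cz v)).
    split; [apply sign_isometry; try lra; transitivity (d ^ 2 * rho ^ 2); [ring|]; rewrite Hd, Hrho; ring|].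
    split; [intros v Hv; change (d * cy v = 0); rewrite Hv; ring|].
    right. exists (d * l2), (d * w2), theta.
    assert (Hd0 : d <> 0) by (intros ->; lra).
    split; [apply Rmult_integral_contrapositive; auto|].
    rewrite Hp, HCe.
    split; apply L3_eq; unfold vscal, vadd, cx, cy, cz; simpl; try ring.
    + transitivity (rho ^ 2 * (d * l2 * C)); [ring|]. rewrite Hrho. ring.
    + transitivity (- d ^ 2 * C + d * w2 * p); [ring|]. rewrite Hd. ring.
    + transitivity (- (d ^ 2 * rho ^ 2) * p + rho ^ 2 * (d * w2 * C)); [ring|].
      rewrite Hd, Hrho. ring.
Qed.

(** * Normal forms *)

Lemma diffeo_id (J : R -> Prop) : open J -> diffeo J J (fun t => t).
Proof.
  intros HJ. split; [|split].
  - apply (smooth_coind J (fun f => f = (fun t => t) \/ exists c, f = fun _ => c)); auto.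
    intros f [->|[c ->]].
    + exists (fun _ => 1). split; [eauto|]. intros t _. apply @is_derive_id.
    + exists (fun _ => 0). split; [eauto|]. intros t _. apply @is_derive_const.
  - intros s _. rewrite Derive_id. lra.
  - intros x. split; [eauto|]. intros [s [Hs <-]]. exact Hs.
Qed.

(** A curve in a plane [y = const] with [x'^2 - z'^2 = 1] has [x' <> 0], so it is a
    graph over [x]. The constants of integration of [alpha] and of [beta] go
    into the translation part of the rigid motion. *)
Lemma translation_graph_form (I J : R -> Prop) (alpha beta b : R -> L3) (Phi : L3 -> L3) :
  is_open_interval I -> is_open_interval J ->
  smooth_curve I alpha -> smooth_curve J beta -> arc_length I alpha ->
  linear_isometry Phi -> (forall s, I s -> cy (Phi (vderiv alpha s)) = 0) ->
  (forall t, J t -> is_vderive b t (Phi (vderiv beta t))) ->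
  exists (T : L3 -> L3) (I' : R -> Prop) (f : R -> R),
    rigid_motion T /\ is_open_interval I' /\ smooth_on I' f /\
    parametrized_by I J (fun s t => T (translation alpha beta s t))
      I' J (translation (graph_curve f) b) /\
    (forall x, I' x -> exists s, I s /\ cx (Phi (alpha s)) = x /\ f x = cz (Phi (alpha s)) /\
       Derive f x = cz (Phi (vderiv alpha s)) / cx (Phi (vderiv alpha s))).
Proof.
  intros HI HJ Sa Sb Ha HPhi Hy Hb.
  set (A := fun s => Phi (alpha s)).
  assert (DA : forall s, I s -> is_vderive A s (Phi (vderiv alpha s))).
  { intros s Is. apply is_vderive_linear; [apply HPhi|]. now apply (smooth_is_vderive I). }
  assert (SA : smooth_curve I A) by (apply smooth_linear; [apply HI|apply HPhi|exact Sa]).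
  assert (Hx : forall s, I s -> Derive (fun u => cx (A u)) s = cx (Phi (vderiv alpha s))).
  { intros s Is. apply is_derive_unique, DA, Is. }
  assert (Hz : forall s, I s -> Derive (fun u => cz (A u)) s = cz (Phi (vderiv alpha s))).
  { intros s Is. apply is_derive_unique, DA, Is. }
  assert (Hx0 : forall s, I s -> Derive (fun u => cx (A u)) s <> 0).
  { intros s Is E. rewrite (Hx s Is) in E.
    assert (N := Ha s Is). rewrite <- (proj2 HPhi) in N.
    specialize (Hy s Is). unfold lor in N. rewrite Hy, E in N. nra. }
  destruct (graph_reparam I (fun u => cx (A u)) (fun u => cz (A u)))
    as (I' & f & HI' & Sf & Hd & Hf); [exact HI|apply SA|exact Hx0|apply SA|].
  destruct (proj1 (proj2 HI)) as [s0 Is0].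
  destruct (vderiv_zero_const J (fun t => vadd (Phi (beta t)) (vscal (-1) (b t))) HJ) as [V HV].
  { intros t Jt.
    destruct (is_vderive_linear Phi beta t _ (proj1 HPhi) (smooth_is_vderive J beta t Sb Jt))
      as (B1 & B2 & B3).
    destruct (Hb t Jt) as (C1 & C2 & C3).
    split; [|split].
    - apply (is_derive_ext (fun u => cx (Phi (beta u)) - cx (b u))).
      { intros u. change (cx (Phi (beta u)) - cx (b u) = cx (Phi (beta u)) + (-1) * cx (b u)). ring. }
      eapply is_derive_eq; [apply is_derive_minus_R; eassumption|]. apply Rminus_diag_eq; reflexivity.
    - apply (is_derive_ext (fun u => cy (Phi (beta u)) - cy (b u))).
      { intros u. change (cy (Phi (beta u)) - cy (b u) = cy (Phi (beta u)) + (-1) * cy (b u)). ring. }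
      eapply is_derive_eq; [apply is_derive_minus_R; eassumption|]. apply Rminus_diag_eq; reflexivity.
    - apply (is_derive_ext (fun u => cz (Phi (beta u)) - cz (b u))).
      { intros u. change (cz (Phi (beta u)) - cz (b u) = cz (Phi (beta u)) + (-1) * cz (b u)). ring. }
      eapply is_derive_eq; [apply is_derive_minus_R; eassumption|]. apply Rminus_diag_eq; reflexivity. }
  set (c := vadd (vscal (-1) V) (0, - cy (A s0), 0)).
  exists (fun p => vadd (Phi p) c), I', f.
  split; [exists Phi, c; split; [apply HPhi|split; [apply HPhi|reflexivity]]|].
  split; [exact HI'|]. split; [exact Sf|]. split.
  - exists (fun u => cx (A u)), (fun t => t).
    split; [exact Hd|]. split; [apply diffeo_id, HJ|].
    intros s t Is Jt. unfold translation. rewrite (proj1 (proj1 HPhi)).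
    assert (Ey : cy (A s) = cy (A s0)).
    { apply (is_derive_zero_const I (fun u => cy (A u))); auto.
      intros u Iu. eapply is_derive_eq; [apply DA, Iu|apply Hy, Iu]. }
    unfold c, graph_curve. fold (A s). rewrite <- (HV t Jt).
    rewrite (proj1 (Hf s Is)), <- Ey. generalize (A s) (Phi (beta t)) (b t). clear.
    intros x y z. apply L3_eq; coords; ring.
  - intros x Ix. destruct (proj1 (proj2 (proj2 Hd) x) Ix) as [s [Is E]].
    exists s. split; [exact Is|]. split; [exact E|]. rewrite <- E.
    destruct (Hf s Is) as [F1 F2]. split; [exact F1|]. rewrite F2, Hx, Hz by exact Is. reflexivity.
Qed.

(** [profile_first_integral] for the curve [Phi o alpha] in a plane [y = const]. *)
Lemma planar_profile (I : R -> Prop) (alpha : R -> L3) (Phi : L3 -> L3) (p q : R) :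
  is_open_interval I -> smooth_curve I alpha -> arc_length I alpha ->
  linear_isometry Phi -> (forall s, I s -> cy (Phi (vderiv alpha s)) = 0) ->
  (forall s, I s ->
     cx (Phi (vderiv alpha s)) * cz (Phi (vderiv2 alpha s))
     - cz (Phi (vderiv alpha s)) * cx (Phi (vderiv2 alpha s))
     = p * cx (Phi (vderiv alpha s)) + q * cz (Phi (vderiv alpha s))) ->
  exists a, forall s, I s ->
    cz (Phi (vderiv alpha s)) / cx (Phi (vderiv alpha s))
    = tanh (p * cx (Phi (alpha s)) + q * cz (Phi (alpha s)) + a).
Proof.
  intros HI Sa Ha HPhi Hy HK.
  assert (D0 : forall s, I s -> is_vderive (fun u => Phi (alpha u)) s (Phi (vderiv alpha s))).
  { intros s Is. apply is_vderive_linear; [apply HPhi|now apply (smooth_is_vderive I)]. }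
  assert (D1 : forall s, I s ->
            is_vderive (fun u => Phi (vderiv alpha u)) s (Phi (vderiv2 alpha s))).
  { intros s Is. apply is_vderive_linear; [apply HPhi|].
    apply (smooth_is_vderive I); [now apply smooth_vderiv|exact Is]. }
  apply (profile_first_integral I _ _ (fun s => cx (Phi (vderiv alpha s)))
           (fun s => cz (Phi (vderiv alpha s))) (fun s => cx (Phi (vderiv2 alpha s)))
           (fun s => cz (Phi (vderiv2 alpha s)))); [exact HI| | | |exact HK].
  - intros s Is. split; apply (D0 s Is).
  - intros s Is. split; apply (D1 s Is).
  - intros s Is. rewrite <- (Ha s Is), <- (proj2 HPhi). unfold lor. rewrite (Hy s Is). ring.
Qed.

Lemma parabola_vderiv (m b t : R) :
  is_vderive (fun t => vadd (vscal (m * (t ^ 2 / 2)) (1, 0, 1)) (vscal t (b, 1, b))) t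
    (m * t + b, 1, m * t + b).
Proof.
  split; [|split]; unfold vadd, vscal, cx, cy, cz; simpl; auto_derive; auto; field.
Qed.

Lemma exponential_vderiv (k m theta t : R) :
  is_vderive (fun t => vadd (vscal (exp (k * t) * m) (sinh theta, 1, cosh theta))
                            (vscal (- t) (cosh theta, 0, sinh theta))) t
    (vadd (vscal (k * m * exp (k * t)) (sinh theta, 1, cosh theta))
          (vscal (-1) (cosh theta, 0, sinh theta))).
Proof.
  split; [|split]; unfold vadd, vscal, cx, cy, cz; simpl; auto_derive; auto; ring.
Qed.

Lemma tanh_opp x : tanh (- x) = - tanh x.
Proof.
  unfold tanh, sinh, cosh. rewrite Ropp_involutive.
  field. apply Rgt_not_eq. generalize (exp_pos x) (exp_pos (- x)); lra.
Qed.

Definition has_normal_form (I J : R -> Prop) (alpha beta : R -> L3) : Prop :=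
  exists (T : L3 -> L3) (I' J' : R -> Prop) (f : R -> R) (b : R -> L3),
     rigid_motion T /\ is_open_interval I' /\ is_open_interval J' /\ smooth_on I' f /\
     parametrized_by I J (fun s t => T (translation alpha beta s t))
       I' J' (translation (graph_curve f) b) /\
     (quadratic_case I' J' f b \/ exponential_case I' J' f b).

(** With [L] in the plane of [alpha], the maximal equation reads
    [x' z'' - z' x'' = - l g (x' - z')]. The variables separate: [g] is a constant,
    so [beta'] is affine in [t] and [alpha] satisfies the hypothesis of
    [planar_profile]. *)
Lemma quadratic_normal_form (I J : R -> Prop) (alpha beta : R -> L3) (Phi : L3 -> L3)
    (W L : L3) (G g : R -> R) (l b : R) :
  is_open_interval I -> is_open_interval J ->
  smooth_curve I alpha -> smooth_curve J beta -> arc_length I alpha ->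
  linear_isometry Phi ->
  (forall s, I s -> cy (Phi (vderiv alpha s)) = 0 /\ cy (Phi (vderiv2 alpha s)) = 0) ->
  (forall t, J t -> vderiv beta t = vadd W (vscal (G t) L) /\ is_derive G t (g t) /\ g t <> 0) ->
  (forall s t, I s -> J t ->
     det3 (vderiv alpha s) (vadd W (vscal (G t) L))
          (vadd (vderiv2 alpha s) (vscal (g t) L)) = 0) ->
  l <> 0 -> Phi L = vscal l (1, 0, 1) -> Phi W = (b, 1, b) ->
  has_normal_form I J alpha beta.
Proof.
  intros HI HJ Sa Sb Ha HPhi Hy Hr HE Hl HL HW.
  assert (HQ : forall s t, I s -> J t ->
    cx (Phi (vderiv alpha s)) * cz (Phi (vderiv2 alpha s))
    - cz (Phi (vderiv alpha s)) * cx (Phi (vderiv2 alpha s))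
    = - (g t * l) * (cx (Phi (vderiv alpha s)) - cz (Phi (vderiv alpha s)))).
  { intros s t Is Jt. generalize (HE s t Is Jt). rewrite <- (linear_isometry_det3 Phi) by exact HPhi.
    destruct HPhi as [[Padd Pscal] _]. rewrite !Padd, !Pscal, HL, HW.
    destruct (Hy s Is) as [Y1 Y2]. revert Y1 Y2.
    generalize (Phi (vderiv alpha s)) (Phi (vderiv2 alpha s)) (G t) (g t).
    clear. intros x y p q. coords. intros -> ->. lra. }
  assert (Hu : forall s, I s -> cx (Phi (vderiv alpha s)) - cz (Phi (vderiv alpha s)) <> 0).
  { intros s Is E. assert (N := Ha s Is). rewrite <- (proj2 HPhi) in N. unfold lor in N.
    rewrite (proj1 (Hy s Is)) in N.
    replace (cx (Phi (vderiv alpha s))) with (cz (Phi (vderiv alpha s))) in N by lra. lra. }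
  destruct (proj1 (proj2 HI)) as [s0 Is0]. destruct (proj1 (proj2 HJ)) as [t0 Jt0].
  set (k := g t0).
  assert (Hg : forall t, J t -> g t = k).
  { intros t Jt. assert (E := HQ s0 t Is0 Jt). rewrite (HQ s0 t0 Is0 Jt0) in E. fold k in E.
    specialize (Hu s0 Is0). apply Rmult_eq_reg_r in E; [|exact Hu].
    apply (Rmult_eq_reg_r l); [lra|exact Hl]. }
  assert (HG : forall t, J t -> G t = k * t + (G t0 - k * t0)).
  { intros t Jt. assert (E : G t - k * t = G t0 - k * t0); [|lra].
    apply (is_derive_zero_const J (fun u => G u - k * u)); auto.
    intros u Ju. destruct (Hr u Ju) as (_ & DG & _). rewrite (Hg u Ju) in DG.
    eapply is_derive_eq; [apply is_derive_minus_R; [exact DG|]|].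
    - apply is_derive_scal, @is_derive_id.
    - change (k - k * 1 = 0). ring. }
  (* In [Phi] coordinates [beta' = (b + l G, 1, b + l G)] and [l G = m t + (b1 - b)]. *)
  set (m := l * k). set (b1 := b + l * (G t0 - k * t0)).
  assert (m0 : m <> 0).
  { apply Rmult_integral_contrapositive. split; [exact Hl|]. apply (Hr t0 Jt0). }
  destruct (planar_profile I alpha Phi (- m) m HI Sa Ha HPhi) as [a Hprof].
  { intros s Is. apply (Hy s Is). }
  { intros s Is. rewrite (HQ s t0 Is Jt0). unfold m, k. ring. }
  destruct (translation_graph_form I J alpha beta
    (fun t => vadd (vscal (m * (t ^ 2 / 2)) (1, 0, 1)) (vscal t (b1, 1, b1))) Phi)
    as (T & I' & f & HT & HI' & Sf & Hpar & Hf); auto.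
  { intros s Is. apply (Hy s Is). }
  { intros t Jt. destruct (Hr t Jt) as (Eb & _). rewrite Eb.
    rewrite (proj1 (proj1 HPhi)), (proj2 (proj1 HPhi)), HL, HW, (HG t Jt).
    replace (vadd _ _) with (m * t + b1, 1, m * t + b1); [apply parabola_vderiv|].
    unfold m, b1. clear. generalize (G t0). intros x. apply L3_eq; coords; ring. }
  eexists T, I', J, f, _. split; [exact HT|]. split; [exact HI'|]. split; [exact HJ|].
  split; [exact Sf|]. split; [exact Hpar|]. left.
  exists m, b1, (- a). split; [exact m0|]. split; [|reflexivity].
  intros x Ix. destruct (Hf x Ix) as (s & Is & Ex & Ef & Edf).
  rewrite Edf, (Hprof s Is), Ex, <- Ef, <- tanh_opp. f_equal. ring.
Qed.

(** With [L] transversal to the plane of [alpha] and [h] the second coordinate of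
    [Phi o beta'], the maximal equation reads [h (x' z'' - z' x'') = h' D], with
    [D = cosh theta z' - sinh theta x']. The variables separate into [h' = k h] and
    [x' z'' - z' x'' = k D]. *)
Lemma exponential_normal_form (I J : R -> Prop) (alpha beta : R -> L3) (Phi : L3 -> L3)
    (W L : L3) (G g : R -> R) (l w theta : R) :
  is_open_interval I -> is_open_interval J ->
  smooth_curve I alpha -> smooth_curve J beta -> arc_length I alpha ->
  linear_isometry Phi ->
  (forall s, I s -> cy (Phi (vderiv alpha s)) = 0 /\ cy (Phi (vderiv2 alpha s)) = 0) ->
  (forall t, J t -> vderiv beta t = vadd W (vscal (G t) L) /\ is_derive G t (g t) /\ g t <> 0) ->
  (forall s t, I s -> J t ->
     det3 (vderiv alpha s) (vadd W (vscal (G t) L))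
          (vadd (vderiv2 alpha s) (vscal (g t) L)) = 0) ->
  (forall s, I s -> det3 (vderiv alpha s) W L <> 0) ->
  l <> 0 -> Phi L = vscal l (sinh theta, 1, cosh theta) ->
  Phi W = vadd (vscal w (sinh theta, 1, cosh theta)) (vscal (-1) (cosh theta, 0, sinh theta)) ->
  has_normal_form I J alpha beta.
Proof.
  intros HI HJ Sa Sb Ha HPhi Hy Hr HE Hu Hl HL HW.
  set (kappa := fun s => cx (Phi (vderiv alpha s)) * cz (Phi (vderiv2 alpha s))
    - cz (Phi (vderiv alpha s)) * cx (Phi (vderiv2 alpha s))).
  set (D := fun s => cosh theta * cz (Phi (vderiv alpha s)) - sinh theta * cx (Phi (vderiv alpha s))).
  set (h := fun t => w + l * G t).
  assert (HQ : forall s t, I s -> J t -> h t * kappa s = l * g t * D s).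
  { intros s t Is Jt. generalize (HE s t Is Jt). rewrite <- (linear_isometry_det3 Phi) by exact HPhi.
    destruct HPhi as [[Padd Pscal] _]. rewrite !Padd, !Pscal, HL, HW.
    destruct (Hy s Is) as [Y1 Y2]. revert Y1 Y2. unfold kappa, D, h.
    generalize (Phi (vderiv alpha s)) (Phi (vderiv2 alpha s)) (G t) (g t) (sinh theta) (cosh theta).
    clear. intros x y p q S C. coords. intros -> ->. lra. }
  assert (HD : forall s, I s -> D s <> 0).
  { intros s Is E. apply (Hu s Is). rewrite <- (linear_isometry_det3 Phi) by exact HPhi.
    rewrite HL, HW. transitivity (- l * D s); [|rewrite E; ring].
    destruct (Hy s Is) as [Y1 _]. revert Y1. unfold D.
    generalize (Phi (vderiv alpha s)) (sinh theta) (cosh theta).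
    clear. intros x S C. coords. intros ->. ring. }
  destruct (proj1 (proj2 HI)) as [s0 Is0]. destruct (proj1 (proj2 HJ)) as [t0 Jt0].
  set (k := kappa s0 / D s0).
  assert (Hg : forall t, J t -> l * g t = k * h t).
  { intros t Jt. unfold k. apply (Rmult_eq_reg_r (D s0)); [|apply HD, Is0].
    rewrite <- (HQ s0 t Is0 Jt). field. apply HD, Is0. }
  assert (Hlg : forall t, J t -> l * g t <> 0).
  { intros t Jt. apply Rmult_integral_contrapositive. split; [exact Hl|apply (Hr t Jt)]. }
  assert (k0 : k <> 0).
  { intros E. apply (Hlg t0 Jt0). rewrite (Hg t0 Jt0), E. ring. }
  assert (h0 : h t0 <> 0).
  { intros E. apply (Hlg t0 Jt0). rewrite (Hg t0 Jt0), E. ring. }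
  assert (Hk : forall s, I s -> kappa s = k * D s).
  { intros s Is. apply (Rmult_eq_reg_l (h t0)); [|exact h0].
    rewrite (HQ s t0 Is Jt0), (Hg t0 Jt0). ring. }
  set (c := h t0 * exp (- k * t0)).
  assert (Hh : forall t, J t -> h t = c * exp (k * t)).
  { intros t Jt.
    assert (E : h t * exp (- k * t) = c).
    { apply (is_derive_zero_const J (fun u => h u * exp (- k * u))); auto.
      intros u Ju. destruct (Hr u Ju) as (_ & DG & _).
      eapply is_derive_eq; [apply is_derive_mult_R|].
      - apply (is_derive_ext (fun v => l * G v + w)); [intros v; unfold h; apply Rplus_comm|].
        apply @is_derive_plus; [apply is_derive_scal, DG|apply @is_derive_const].
      - instantiate (1 := - k * exp (- k * u)). auto_derive; auto. ring.
      - change ((l * g u + 0) * exp (- k * u) + h u * (- k * exp (- k * u)) = 0).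
        rewrite (Hg u Ju). ring. }
    rewrite <- E, Rmult_assoc, <- exp_plus.
    replace (- k * t + k * t) with 0 by ring. rewrite exp_0. ring. }
  assert (c0 : c <> 0).
  { intros E. apply h0. rewrite (Hh t0 Jt0), E. ring. }
  (* In [Phi o beta'] the coefficient [c exp (k t)] of [(sinh theta, 1, cosh theta)]
     integrates to [(c / k) exp (k t)]. *)
  set (m := c / k).
  assert (m0 : m <> 0).
  { apply Rmult_integral_contrapositive. split; [exact c0|now apply Rinv_neq_0_compat]. }
  destruct (planar_profile I alpha Phi (- (k * sinh theta)) (k * cosh theta) HI Sa Ha HPhi)
    as [a Hprof].
  { intros s Is. apply (Hy s Is). }
  { intros s Is. fold (kappa s). rewrite (Hk s Is). unfold D. ring. }
  destruct (translation_graph_form I J alpha beta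
    (fun t => vadd (vscal (exp (k * t) * m) (sinh theta, 1, cosh theta))
                   (vscal (- t) (cosh theta, 0, sinh theta))) Phi)
    as (T & I' & f & HT & HI' & Sf & Hpar & Hf); auto.
  { intros s Is. apply (Hy s Is). }
  { intros t Jt. destruct (Hr t Jt) as (Eb & _). rewrite Eb.
    rewrite (proj1 (proj1 HPhi)), (proj2 (proj1 HPhi)), HL, HW.
    replace (vadd _ _) with (vadd (vscal (k * m * exp (k * t)) (sinh theta, 1, cosh theta))
          (vscal (-1) (cosh theta, 0, sinh theta))); [apply exponential_vderiv|].
    replace (k * m * exp (k * t)) with (h t)
      by (rewrite (Hh t Jt); unfold m; field; exact k0).
    unfold h. clear. generalize (G t) (sinh theta) (cosh theta).
    intros x S C. apply L3_eq; coords; ring. }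
  eexists T, I', J, f, _. split; [exact HT|]. split; [exact HI'|]. split; [exact HJ|].
  split; [exact Sf|]. split; [exact Hpar|]. right.
  exists a, k, theta, m. split; [exact k0|]. split; [exact m0|]. split; [|reflexivity].
  intros x Ix. destruct (Hf x Ix) as (s & Is & Ex & Ef & Edf).
  rewrite Edf, (Hprof s Is), Ex, <- Ef. f_equal. ring.
Qed.

Theorem theorem3p2 (I J : R -> Prop) (alpha beta : R -> L3)
    (Htrans : translation_surface I J alpha beta)
    (Hspacelike : spacelike_surface I J (translation alpha beta))
    (Halpha : forall s : R, I s -> timelike (vderiv2 alpha s))
    (Hbeta : pseudo_null J beta)
    (Hmax : maximal I J (translation alpha beta)) :
  (surface_in_plane I J (translation alpha beta) \/
   (planar I alpha /\ planar J beta)) /\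
  (planar I alpha /\ planar J beta ->
   exists (T : L3 -> L3) (I' J' : R -> Prop) (f : R -> R) (b : R -> L3),
     rigid_motion T /\ is_open_interval I' /\ is_open_interval J' /\ smooth_on I' f /\
     parametrized_by I J (fun s t => T (translation alpha beta s t))
       I' J' (translation (graph_curve f) b) /\
     (quadratic_case I' J' f b \/ exponential_case I' J' f b)).
Proof.
  destruct Htrans as (HI & HJ & (Sa & _ & Ha & _) & (Sb & _ & Hb & _) & _).
  destruct (pseudo_null_ruling J beta HJ Hbeta) as (W & L & G & g & HWW & HWL & HL & Hr).
  assert (HE : forall s t, I s -> J t ->
     det3 (vderiv alpha s) (vadd W (vscal (G t) L))
          (vadd (vderiv2 alpha s) (vscal (g t) L)) = 0).
  { intros s t Is Jt. destruct (Hr t Jt) as (E1 & E2 & _). rewrite <- E1, <- E2.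
    now apply (maximal_translation_equation I J). }
  destruct (proj1 (proj2 HI)) as [s0 Is0]. destruct (proj1 (proj2 HJ)) as [t0 Jt0].
  assert (Hu : forall s, I s -> det3 (vderiv alpha s) W L <> 0).
  { intros s Is. destruct (Hr t0 Jt0) as (E1 & _).
    apply (det3_ruling_ne _ (vderiv beta t0) W L (G t0)); auto.
    now apply (tangent_plane_spacelike I J). }
  split.
  - right. split.
    + destruct (affine_separation I J
        (fun s => lor (lcross (vderiv alpha s) (vderiv2 alpha s)) W)
        (fun s => lor (lcross (vderiv alpha s) (vderiv2 alpha s)) L)
        (fun s => det3 (vderiv alpha s) W L) G g HJ) as (A & B & HAB).
      * intros t Jt. apply (Hr t Jt).
      * intros s t Is Jt. generalize (HE s t Is Jt). rewrite det3_ruling. lra.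
      * apply (constant_normal I alpha W L A B); auto.
    + apply (planar_of_normal J beta (lcross W L)); auto.
      * intros E. apply (Hu s0 Is0).
        transitivity (lor (lcross W L) (vderiv alpha s0)).
        -- generalize (vderiv alpha s0). clear. intros x. coords. ring.
        -- rewrite E. generalize (vderiv alpha s0). clear. intros x. coords. ring.
      * intros t Jt. destruct (Hr t Jt) as (E1 & _). rewrite E1. clear.
        generalize (G t). intros x. coords. ring.
  - intros [Hpa _]. destruct (planar_normal I alpha HI Sa Hpa) as (n & n0 & Hn).
    assert (Hn2 : forall s, I s -> lor n (vderiv2 alpha s) = 0).
    { intros s Is.
      apply (is_derive_const_on I (fun u => lor n (vderiv alpha u)) s _ 0); [apply HI|exact Is|exact Hn|].
      eapply is_derive_eq.
      - apply (is_derive_lor (fun _ => n) (vderiv alpha)); [apply is_vderive_const|].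
        apply (smooth_is_vderive I); [now apply smooth_vderiv|exact Is].
      - fold (vderiv2 alpha s). generalize (vderiv alpha s) (vderiv2 alpha s). clear.
        intros x y. coords. ring. }
    destruct (adapted_isometry (vderiv alpha s0) (vderiv2 alpha s0) n) as (Phi & HPhi & HPn); auto.
    { now apply (arc_length_orthogonal I), Is0; [apply HI|..]. }
    destruct (normal_position (Phi W) (Phi L)) as (Sigma & HSigma & HSy & Hcase).
    { now rewrite (proj2 HPhi). }
    { now rewrite (proj2 HPhi). }
    { split; [rewrite (proj2 HPhi); apply HL|]. apply linear_isometry_ne; [exact HPhi|apply HL]. }
    assert (HPsi := linear_isometry_comp Phi Sigma HPhi HSigma).
    assert (Hy : forall s, I s -> cy (Sigma (Phi (vderiv alpha s))) = 0 /\
                                  cy (Sigma (Phi (vderiv2 alpha s))) = 0) by (intros s Is; auto).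
    assert (Hr' : forall t, J t -> vderiv beta t = vadd W (vscal (G t) L) /\
              is_derive G t (g t) /\ g t <> 0).
    { intros t Jt. destruct (Hr t Jt) as (E1 & _ & E3). auto. }
    destruct Hcase as [(l & b & l0 & EL & EW)|(l & w & theta & l0 & EL & EW)].
    + exact (quadratic_normal_form I J alpha beta _ W L G g l b
               HI HJ Sa Sb Ha HPsi Hy Hr' HE l0 EL EW).
    + exact (exponential_normal_form I J alpha beta _ W L G g l w theta
               HI HJ Sa Sb Ha HPsi Hy Hr' HE Hu l0 EL EW).
Qed.
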